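(* For every constant $\epsilon>0$ there exists $\alpha_0>0$ such that the following holds for every constant $0<\alpha\le\alpha_0$. Let $p=\frac{1+\epsilon}{d}$ and let $L_1$ be the largest component of $Q^d_p$. Then there exists a constant $\beta>0$ such that with high probability every subset $S\subseteq V(L_1)$ satisfying $\alpha n\le |S|\le \frac{|V(L_1)|}{2}$ has edge boundary in $Q^d_p$ satisfying $|\partial_{e,p}(S)|\ge \beta\frac{n}{d^3(\log d)^2}$.
   Context: $Q^d$ denotes the $d$-dimensional hypercube: vertex set $\{0,1\}^d$, two vertices adjacent iff they differ in exactly one coordinate; $n:=2^d$. $Q^d_p$ denotes the random subgraph of $Q^d$ on the same vertex set obtained by retaining each edge of $Q^d$ independently with probability $p$. For $S\subseteq V(Q^d)$, $\partial_{e,p}(S)$ is the set of edges of $Q^d_p$ with one endpoint in $S$ and the other in $V(Q^d)\setminus S$. ''With high probability'' means with probability tending to one as $d\to\infty$. *)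

(* Defs.v *)
From HB Require Import structures.
From mathcomp Require Import all_boot all_order all_algebra.
From mathcomp Require Import reals exp.
Set Implicit Arguments. Unset Strict Implicit. Unset Printing Implicit Defensive.
Import Order.TTheory GRing.Theory Num.Theory.
Local Open Scope ring_scope.

Definition cube (d : nat) : finType := {ffun 'I_d -> bool}.

Definition qadj (d : nat) (x y : cube d) : bool :=
  #|[set i : 'I_d | x i != y i]| == 1%N.

Definition qedges (d : nat) : {set {set cube d}} :=
  [set e : {set cube d} | [exists x : cube d, exists y : cube d,
     qadj x y && (e == [set x; y])]].

(* A spanning subgraph of Q^d is given by its edge set G \subset qedges d.
   Probability that Q^d_p has edge set G. *)
Definition qweight (R : realType) (d : nat) (p : R) (G : {set {set cube d}}) : R :=
  p ^+ #|G| * (1 - p) ^+ (#|qedges d| - #|G|).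

Definition qprob (R : realType) (d : nat) (p : R)
    (A : {set {set cube d}} -> bool) : R :=
  \sum_(G in powerset (qedges d) | A G) qweight p G.

Definition grel (d : nat) (G : {set {set cube d}}) : rel (cube d) :=
  fun x y => [set x; y] \in G.

Definition gcomp (d : nat) (G : {set {set cube d}}) (x : cube d) : {set cube d} :=
  [set y | connect (grel G) x y].

Definition is_comp (d : nat) (G : {set {set cube d}}) (C : {set cube d}) : bool :=
  [exists x, C == gcomp G x].

Definition is_largest_comp (d : nat) (G : {set {set cube d}}) (C : {set cube d}) : bool :=
  is_comp G C && [forall C' : {set cube d}, is_comp G C' ==> (#|C'| <= #|C|)%N].

Definition eboundary (d : nat) (G : {set {set cube d}}) (S : {set cube d})
    : {set {set cube d}} :=
  [set e in G | #|e :&: S| == 1%N].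

(* Main.v *)
Require Import Defs.
From HB Require Import structures.
From mathcomp Require Import all_boot all_order all_algebra.
From mathcomp Require Import reals sequences exp.
From mathcomp Require Import zify lra ring.
Set Implicit Arguments. Unset Strict Implicit. Unset Printing Implicit Defensive.
Import Order.TTheory GRing.Theory Num.Theory.
Local Open Scope ring_scope.

(* Write n = 2^d and split the random graph as G1 u G2 u G3 u G4, where G2, G3, G4 are
   independent of G1 and have density delta/d for a small constant delta. Let W be the set
   of vertices whose G1-component has at least K = C d vertices.
   - Revealing a component edge by edge and tilting the edge density by a factor
     1 - s gives an exponential moment bound for the size of small components. Hence few
     vertices have G1-components of size between k and K, so a large component of the
     whole graph lies in W up to few vertices. Applying the bound in disjoint subcubes
     shows that all but few vertices have linearly (in d) many neighbours in W.
   - Closed walks around spanning trees, cut into pieces of length K, cover W by at most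
     3n/K pieces, and a set S with small boundary splits few of them. The pieces inside S
     and those outside S form two sets A and B, for which there are only 4^(3n/K) choices.
   - For fixed linear-sized A and B covering most of W, almost every vertex has many
     neighbours in A or in B, so by the Poincare inequality linearly many edges of the cube
     join the vertices attached to A to those attached to B. With probability
     1 - exp(-c n/d), G2, G3, G4 extend order n/d of these edges to paths of length
     at most 3 from A to B. As C is large, this survives the union bound, and each such
     path contains an edge of the boundary of S.
   The constants depend on the failure probability eta, so Markov's inequality suffices
   everywhere; the resulting bound n/d^3 beats n/(d^3 (log d)^2), which makes beta = 1 valid. *)

(** * Bernoulli random subsets *)

Section Bernoulli.
Variables (R : realType) (T : finType).
Implicit Types (p : R) (E F G : {set T}) (f g : {set T} -> R).

(** Expectation of [f] over a [p]-random subset of [E]; probabilities are the expectations of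
    indicators cast to [R]. *)
Definition bern p E f : R :=
  \sum_(G in powerset E) p ^+ #|G| * (1 - p) ^+ (#|E| - #|G|) * f G.

Lemma eq_bern p E f g :
  (forall G, G \subset E -> f G = g G) -> bern p E f = bern p E g.
Proof.
by move=> fg; apply: eq_bigr => G; rewrite powersetE => GE; rewrite fg.
Qed.

Lemma bern0 p f : bern p set0 f = f set0.
Proof. by rewrite /bern powerset0 big_set1 cards0 !expr0 !mul1r. Qed.

(** Conditioning on whether [e] is chosen. Together with [set_ind_D1] this proves statements about
    [bern] by exposing one element at a time. *)
Lemma bern_step p E e f : e \in E ->
  bern p E f = p * bern p (E :\ e) (fun G => f (e |: G))
             + (1 - p) * bern p (E :\ e) f.
Proof.
move=> eE; have cE : #|E| = #|E :\ e|.+1 by rewrite (cardsD1 e) eE.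
rewrite /bern (bigID (fun G : {set T} => e \in G)) /=; congr (_ + _).
  rewrite (reindex_onto (fun G => e |: G) (fun G => G :\ e)) /=; last first.
    by move=> G /andP[_ eG]; rewrite setD1K.
  rewrite big_distrr /=; apply: eq_big => [G|G /andP[/andP[GE _] /eqP eG]].
    rewrite !powersetE subsetD1 subUset sub1set eE setU11 /= andbT.
    case eG: (e \in G); last by rewrite setU1K ?eG // eqxx.
    by rewrite andbF; apply/andP => -[_ /eqP/setP/(_ e)]; rewrite !inE eqxx eG.
  have eG' : e \notin G by rewrite -eG !inE eqxx.
  by rewrite cardsU1 eG' cE add1n subSS exprS !mulrA.
rewrite big_distrr /=; apply: eq_big => [G|G].
  by rewrite !powersetE subsetD1.
rewrite powersetE => /andP[GE eG].
rewrite cE subSn ?exprS; last by apply: subset_leq_card; rewrite subsetD1 GE.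
by rewrite mulrCA !mulrA (mulrC (1 - p)).
Qed.

Lemma set_ind_D1 (P : {set T} -> Prop) : P set0 ->
  (forall E e, e \in E -> P (E :\ e) -> P E) -> forall E, P E.
Proof.
move=> P0 PS E; elim: {E}#|E| {-2}E (erefl #|E|) => [|n IHn] E.
  by move/eqP; rewrite cards_eq0 => /eqP->.
move=> cE; have [->//|[e eE]] := set_0Vmem E.
by apply: (PS _ e eE); apply: IHn; move: cE; rewrite (cardsD1 e) eE => -[].
Qed.

Lemma bernD p E f g : bern p E (fun G => f G + g G) = bern p E f + bern p E g.
Proof. by rewrite -big_split; apply: eq_bigr => G _; rewrite mulrDr. Qed.

Lemma bernZ p E c f : bern p E (fun G => c * f G) = c * bern p E f.
Proof. by rewrite /bern big_distrr; apply: eq_bigr => G _ /=; rewrite mulrCA. Qed.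

Lemma bern_sum p E (I : Type) (r : seq I) (P : pred I) (h : I -> {set T} -> R) :
  bern p E (fun G => \sum_(i <- r | P i) h i G) = \sum_(i <- r | P i) bern p E (h i).
Proof.
rewrite /bern exchange_big /=; apply: eq_bigr => G _.
by rewrite big_distrr.
Qed.

Lemma bern_cst p E c : bern p E (fun=> c) = c.
Proof.
elim/set_ind_D1: E => [|E e eE IH]; first by rewrite bern0.
by rewrite (bern_step p _ eE) IH; ring.
Qed.

Lemma bernB p E f g : bern p E (fun G => f G - g G) = bern p E f - bern p E g.
Proof.
rewrite bernD; congr (_ + _); rewrite -mulN1r -bernZ.
by apply: eq_bern => G _; rewrite mulN1r.
Qed.

Lemma ler_bern p E f g : 0 <= p <= 1 ->
  (forall G, G \subset E -> f G <= g G) -> bern p E f <= bern p E g.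
Proof.
move=> /andP[p0 p1] fg; apply: ler_sum => G; rewrite powersetE => GE.
by apply: ler_wpM2l (fg _ GE); rewrite mulr_ge0 ?exprn_ge0 ?subr_ge0.
Qed.

Lemma bern_le_cst p E f c : 0 <= p <= 1 ->
  (forall G, G \subset E -> f G <= c) -> bern p E f <= c.
Proof. by move=> hp fc; rewrite -(bern_cst p E c); apply: ler_bern. Qed.

(** An element avoids [G1 :|: G2] exactly when it avoids both sets, whence the relation between the
    densities. This is what permits sprinkling. *)
Lemma bern_union p p1 p2 E f : 1 - p = (1 - p1) * (1 - p2) ->
  bern p E f = bern p1 E (fun G1 => bern p2 E (fun G2 => f (G1 :|: G2))).
Proof.
move=> hp; elim/set_ind_D1: E f => [|E e eE IH] f.
  by rewrite !bern0 setU0.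
rewrite !(bern_step _ _ eE) !IH.
have -> : bern p1 (E :\ e) (fun G1 => bern p2 E (fun G2 => f ((e |: G1) :|: G2)))
   = bern p1 (E :\ e) (fun G1 => bern p2 (E :\ e) (fun G2 => f (e |: (G1 :|: G2)))).
  apply: eq_bern => G1 _; rewrite (bern_step p2 _ eE).
  rewrite (_ : bern p2 _ (fun G => f ((e |: G1) :|: (e |: G)))
     = bern p2 (E :\ e) (fun G2 => f (e |: (G1 :|: G2)))).
    by under [in X in _ + (1 - _) * X]eq_bern => G _ do rewrite -setUA; ring.
  by apply: eq_bern => G _; rewrite -setUUr.
have -> : bern p1 (E :\ e) (fun G1 => bern p2 E (fun G2 => f (G1 :|: G2)))
   = p2 * bern p1 (E :\ e) (fun G1 => bern p2 (E :\ e) (fun G2 => f (e |: (G1 :|: G2))))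
   + (1 - p2) * bern p1 (E :\ e) (fun G1 => bern p2 (E :\ e) (fun G2 => f (G1 :|: G2))).
  rewrite -!bernZ -bernD; apply: eq_bern => G1 _; rewrite (bern_step p2 _ eE).
  by congr (_ * _ + _); apply: eq_bern => G2 _; rewrite setUCA.
have -> : p = 1 - (1 - p1) * (1 - p2) by rewrite -hp; ring.
by ring.
Qed.

(** Exposing [e] changes only the argument of [f] or only that of [g], depending on whether [e] lies
    in [F], so the product form survives the induction. *)
Lemma bern_indep p E F f g :
  bern p E (fun G => f (G :&: F) * g (G :\: F))
  = bern p E (fun G => f (G :&: F)) * bern p E (fun G => g (G :\: F)).
Proof.
elim/set_ind_D1: E f g => [|E e eE IH] f g; first by rewrite !bern0.
rewrite !(bern_step p _ eE).
have [eF|eF] := boolP (e \in F).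
  have h1 G : (e |: G) :&: F = e |: (G :&: F).
    by rewrite setIUl (setIidPl _) // sub1set.
  have h2 G : (e |: G) :\: F = G :\: F.
    by rewrite setDUl (_ : [set e] :\: F = set0) ?set0U //; apply/eqP; rewrite setD_eq0 sub1set.
  under eq_bern => G _ do rewrite h1 h2.
  under [in RHS]eq_bern => G _ do rewrite h1.
  under [in X in _ = _ * X]eq_bern => G _ do rewrite h2.
  rewrite (IH (fun H => f (e |: H)) g) IH; ring.
have h1 G : (e |: G) :&: F = G :&: F.
  rewrite setIUl (_ : [set e] :&: F = set0) ?set0U //; apply/setP => z; rewrite !inE.
  by case: eqP => // ->; rewrite (negbTE eF).
have h2 G : (e |: G) :\: F = e |: (G :\: F).
  rewrite setDUl (_ : [set e] :\: F = [set e]) //; apply/setP => z; rewrite !inE.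
  by case: eqP => [->|]; rewrite ?eF ?andbF.
under eq_bern => G _ do rewrite h1 h2.
under [in RHS]eq_bern => G _ do rewrite h1.
under [in X in _ = _ * X]eq_bern => G _ do rewrite h2.
rewrite (IH f (fun H => g (e |: H))) IH; ring.
Qed.

Lemma bern_prod p E (I : eqType) (r : seq I) (F : I -> {set T})
    (h : I -> {set T} -> R) : uniq r ->
  {in r &, forall i j, i != j -> [disjoint F i & F j]} ->
  bern p E (fun G => \prod_(i <- r) h i (G :&: F i))
  = \prod_(i <- r) bern p E (fun G => h i (G :&: F i)).
Proof.
elim: r => [|i r IH] /=.
  by rewrite big_nil => _ _; under eq_bern => G _ do rewrite big_nil; rewrite bern_cst.
move=> /andP[ir ur] dis; rewrite big_cons.
under eq_bern => G _ do rewrite big_cons.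
rewrite -IH //; last by move=> j k jr kr; apply: dis; rewrite inE ?jr ?kr orbT.
have e G : \prod_(j <- r) h j (G :&: F j) = \prod_(j <- r) h j ((G :\: F i) :&: F j).
  apply: eq_big_seq => j jr; congr (h j _).
  have /setDidPl d : [disjoint F j & F i].
    by apply: dis; rewrite ?inE ?eqxx ?jr ?orbT //; apply: contraNneq ir => <-.
  by rewrite setIDAC -setIDA d.
under eq_bern => G _ do rewrite e.
under [in X in _ = _ * X]eq_bern => G _ do rewrite e.
exact: (bern_indep p E (F i) (h i) (fun H => \prod_(j <- r) h j (H :&: F j))).
Qed.

Lemma bern_card p E : bern p E (fun G => #|G|%:R) = p * #|E|%:R.
Proof.
elim/set_ind_D1: E => [|E e eE IH]; first by rewrite bern0 cards0 mulr0.
rewrite (bern_step p _ eE) IH.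
rewrite (_ : bern p _ (fun G => #|e |: G|%:R) = bern p (E :\ e) (fun G => 1 + #|G|%:R)).
  by rewrite bernD bern_cst IH (cardsD1 e E) eE add1n -natr1; ring.
by apply: eq_bern => G; rewrite subsetD1 => /andP[_ eG]; rewrite cardsU1 eG natrD.
Qed.

(** The probability equals [1 - (1 - p) ^+ #|F|]. Since [(1 - p) (1 + p) <= 1], Bernoulli's
    inequality for powers of [1 + p] bounds the subtracted power by [1 / (1 + tau)]. *)
Lemma bern_meet p E F tau : 0 <= p <= 1 -> 0 <= tau -> F \subset E ->
  tau <= p * #|F|%:R ->
  tau / (1 + tau) <= bern p E (fun G => (G :&: F != set0)%:R).
Proof.
move=> hp tau0 FE htau; have /andP[p0 p1] := hp.
have none : bern p E (fun G => (G :&: F == set0)%:R) = (1 - p) ^+ #|F|.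
  elim/set_ind_D1: F FE {htau} => [|F e eF IH] FE.
    under eq_bern => G _ do rewrite setI0 eqxx.
    by rewrite bern_cst cards0.
  have eE := subsetP FE _ eF.
  have -> : bern p E (fun G => (G :&: F == set0)%:R) =
    bern p E (fun G => (G :&: [set e] == set0)%:R * ((G :\: [set e]) :&: (F :\ e) == set0)%:R).
    apply: eq_bern => G _; rewrite -natrM mulnb; congr (_ %:R)%R; congr nat_of_bool.
    apply/eqP/andP => [h|[/eqP/setP h1 /eqP/setP h2]].
      split; apply/eqP/setP => z; move/setP/(_ z): h; rewrite !inE.
        by case: eqP => [->|]; rewrite ?andbF // eF.
      by case: eqP.
    apply/setP => z; move: (h1 z) (h2 z); rewrite !inE; case: eqP => [->|_] /=.
      by rewrite andbT eF => ->.
    by [].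
  rewrite (bern_indep p E [set e] (fun H => (H == set0)%:R) (fun H => (H :&: (F :\ e) == set0)%:R)).
  rewrite (_ : bern p E (fun G => (G :&: [set e] == set0)%:R) = 1 - p).
    rewrite (_ : bern p E _ = (1 - p) ^+ #|F :\ e|); first by rewrite (cardsD1 e F) eF exprS.
    rewrite -IH; last by apply: subset_trans FE; apply: subsetDl.
    apply: eq_bern => G _; congr (_ == _)%:R.
    by apply/setP => z; rewrite !inE; case: eqP; rewrite ?andbF.
  rewrite (bern_step p _ eE).
  rewrite (_ : bern p _ _ = 0); last first.
    rewrite -[RHS](bern_cst p (E :\ e)); apply: eq_bern => G _.
    case: eqP => // /setP/(_ e); rewrite !inE eqxx /=; done.
  rewrite (_ : bern p _ _ = 1); last first.
    rewrite -[RHS](bern_cst p (E :\ e)); apply: eq_bern => G.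
    rewrite subsetD1 => /andP[_ eG]; case: eqP => // -[]; apply/setP => z.
    by rewrite !inE; case: eqP => [->|]; rewrite ?andbF // (negbTE eG).
  by rewrite mulr0 mulr1 add0r.
have -> : bern p E (fun G => (G :&: F != set0)%:R) = 1 - (1 - p) ^+ #|F|.
  rewrite -none; transitivity (bern p E (fun=> 1) - bern p E (fun G => (G :&: F == set0)%:R)).
    rewrite -bernB; apply: eq_bern => G _.
    by case: (G :&: F == set0); rewrite /= ?subrr ?subr0.
  by rewrite bern_cst.
have bernoulli : 1 + p * #|F|%:R <= (1 + p) ^+ #|F|.
  elim: {htau none FE}#|F| => [|m IH]; first by rewrite mulr0 addr0.
  rewrite exprS; apply: (@le_trans _ _ ((1 + p) * (1 + p * m%:R))).
    rewrite -(natr1 m); have := mulr_ge0 p0 (mulr_ge0 p0 (ler0n R m)); nra.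
  by apply: ler_wpM2l => //; rewrite addr_ge0.
have le1 : (1 - p) ^+ #|F| * (1 + p) ^+ #|F| <= 1.
  rewrite -exprMn; apply: exprn_ile1; first by rewrite mulr_ge0 ?subr_ge0 ?addr_ge0.
  by have := mulr_ge0 p0 p0; lra.
have q0 : 0 <= (1 - p) ^+ #|F| by rewrite exprn_ge0 // subr_ge0.
have h : (1 - p) ^+ #|F| * (1 + tau) <= 1.
  apply: le_trans le1; apply: ler_wpM2l => //; apply: le_trans bernoulli.
  by rewrite lerD2l.
rewrite ler_pdivrMr; last by rewrite ltr_pwDl.
by rewrite mulrBl mul1r; lra.
Qed.

(** Exponential Markov inequality for the lower tail. The events read disjoint sets [F i], hence are
    independent, and [exp (- w) <= 1 - w / 2] on [[0, 1]] gives [E exp (- X) <= exp (- q M / 2)];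
    the threshold [q M / 4] gives back half of this exponent. *)
Lemma bern_chernoff p E (I : finType) (P : {set I}) (F : I -> {set T})
    (a : I -> {set T} -> bool) (w : I -> R) (q M : R) :
  0 <= p <= 1 -> 0 <= q ->
  (forall i G, i \in P -> a i G = a i (G :&: F i)) ->
  {in P &, forall i j, i != j -> [disjoint F i & F j]} ->
  (forall i, i \in P -> q <= bern p E (fun G => (a i G)%:R)) ->
  (forall i, i \in P -> 0 <= w i <= 1) ->
  M <= \sum_(i in P) w i ->
  bern p E (fun G => (\sum_(i in P) w i * (a i G)%:R < q * M / 4)%R%:R)
    <= expR (- (q * M / 4)).
Proof.
move=> hp q0 aF dis qa w01 hM.
pose X G := \sum_(i in P) w i * (a i G)%:R.
have expN w' : 0 <= w' <= 1 -> expR (- w') <= 1 - w' / 2.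
  move=> /andP[w0 w1]; rewrite expRN -[leRHS]invrK lef_pV2 ?posrE ?expR_gt0 //; last first.
    by rewrite invr_gt0; lra.
  apply: le_trans (expR_ge1Dx w').
  rewrite -[leLHS]mul1r ler_pdivrMr; [nra|lra].
have hX G : (X G < q * M / 4)%R%:R <=
    expR (q * M / 4) * \prod_(i <- enum P) (1 - w i * (a i (G :&: F i))%:R / 2).
  have pos : 0 <= \prod_(i <- enum P) (1 - w i * (a i (G :&: F i))%:R / 2).
    rewrite big_enum; apply: prodr_ge0 => i iP; have /andP[? ?] := w01 _ iP.
    by case: (a _ _) => /=; nra.
  case: ltP => h; last by rewrite mulr_ge0 ?expR_ge0.
  apply: (@le_trans _ _ (expR (q * M / 4) * expR (- X G))).
    by rewrite -expRD -[leLHS]/1 -[leLHS]expR0 ler_expR subr_ge0 ltW.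
  apply: ler_wpM2l; first exact: expR_ge0.
  rewrite /X -sumrN (big_morph expR (@expRD R) (@expR0 R)) big_enum /=.
  apply: ler_prod => i iP; rewrite expR_ge0 -aF //=; apply: expN.
  have /andP[? ?] := w01 _ iP; case: (a _ _) => /=; nra.
apply: le_trans (_ : expR (q * M / 4) * expR (- (q * M / 2)) <= _); last first.
  by rewrite -expRD ler_expR; move: (q * M) => z; lra.
apply: le_trans (ler_bern hp (fun G _ => hX G)) _.
rewrite bernZ; apply: ler_wpM2l; first exact: expR_ge0.
rewrite (bern_prod p E (fun i (H : {set T}) => 1 - w i * (a i H)%:R / 2)); first last.
- by move=> i j; rewrite !mem_enum; apply: dis.
- exact: enum_uniq.
apply: (@le_trans _ _ (expR (\sum_(i in P) - (q / 2 * w i)))); last first.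
  by rewrite ler_expR sumrN -mulr_sumr lerN2; nra.
rewrite (big_morph expR (@expRD R) (@expR0 R)) big_enum /=.
apply: ler_prod => i iP; have /andP[w0 w1] := w01 _ iP.
have -> : bern p E (fun G => 1 - w i * (a i (G :&: F i))%:R / 2)
   = 1 - w i / 2 * bern p E (fun G => (a i G)%:R).
  rewrite bernB bern_cst -bernZ; congr (_ - _); apply: eq_bern => G _.
  by rewrite -aF //; ring.
have qi := qa _ iP.
have q1 : bern p E (fun G => (a i G)%:R) <= 1.
  by apply: bern_le_cst => // G _; case: (a _ _).
apply/andP; split; first by nra.
by apply: le_trans (expR_ge1Dx _); nra.
Qed.

End Bernoulli.

(** * Isoperimetry of the hypercube *)

Section Hypercube.
Local Open Scope nat_scope.
Variable d : nat.
Implicit Types (x y z : cube d) (i j : 'I_d) (S X Y C : {set cube d}) (D : {set 'I_d}).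

Definition flip i x : cube d := [ffun j => x j (+) (j == i)].

Lemma flipK i : involutive (flip i).
Proof. by move=> x; apply/ffunP => j; rewrite !ffunE -addbA addbb addbF. Qed.

Lemma flip_id i x : flip i x i = ~~ x i.
Proof. by rewrite ffunE eqxx addbT. Qed.

Lemma flip_neq_id i j x : j != i -> flip i x j = x j.
Proof. by move=> ij; rewrite ffunE (negbTE ij) addbF. Qed.

Lemma flip_neq i x : flip i x != x.
Proof. by apply/eqP => /ffunP/(_ i); rewrite flip_id; case: (x i). Qed.

Lemma flip_inj x : injective (flip ^~ x).
Proof.
move=> i j /ffunP/(_ i); rewrite !ffunE eqxx.
by case: eqP => // _; case: (x i).
Qed.

Lemma card_cube : #|[set: cube d]| = 2 ^ d.
Proof. by rewrite cardsT card_ffun card_bool card_ord. Qed.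

Lemma set2_eq (T : finType) (a b u v : T) : a != b -> [set a; b] = [set u; v] ->
  (a = u /\ b = v) \/ (a = v /\ b = u).
Proof.
move=> ab eq.
have: a \in [set u; v] by rewrite -eq !inE eqxx.
have: b \in [set u; v] by rewrite -eq !inE eqxx orbT.
rewrite !inE => /orP[]/eqP bE /orP[]/eqP aE; [|by right|by left|];
  by rewrite aE bE eqxx in ab.
Qed.

Lemma qedgesP (e : {set cube d}) :
  reflect (exists x i, e = [set x; flip i x]) (e \in qedges d).
Proof.
rewrite inE; apply: (iffP existsP) => [[x /existsP[y /andP[xy /eqP->]]]|[x [i ->]]].
  have /cards1P[i /setP hi] := xy; exists x, i; congr [set _; _].
  apply/ffunP => j; move: (hi j); rewrite !inE ffunE.
  by case: (j == i); case: (x j); case: (y j).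
exists x; apply/existsP; exists (flip i x); rewrite eqxx andbT.
apply/cards1P; exists i; apply/setP => j; rewrite !inE ffunE.
by case: (j == i); case: (x j).
Qed.

Lemma qedge_flip x i : [set x; flip i x] \in qedges d.
Proof. by apply/qedgesP; exists x, i. Qed.

Definition deg S x := \sum_(i < d) (flip i x \in S).

Lemma deg_le S x : deg S x <= d.
Proof.
rewrite /deg -[leqRHS]card_ord -sum1_card; apply: leq_sum => i _.
by case: (_ \in _).
Qed.

Lemma degS S X x : S \subset X -> deg S x <= deg X x.
Proof.
by move=> SX; apply: leq_sum => i _; case: (boolP (_ \in S)) => // /(subsetP SX) ->.
Qed.

Lemma degU S X x : deg (S :|: X) x <= deg S x + deg X x.
Proof.
rewrite /deg -big_split; apply: leq_sum => i _ /=; rewrite !inE.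
by case: (_ \in S); case: (_ \in X).
Qed.

Lemma sum_deg_sym X Y : \sum_(x in X) deg Y x = \sum_(y in Y) deg X y.
Proof.
rewrite /deg exchange_big [RHS]exchange_big /=; apply: eq_bigr => i _.
rewrite big_mkcond [RHS]big_mkcond (reindex_inj (inv_inj (@flipK i))) /=.
by apply: eq_bigr => x _; rewrite flipK; do 2 case: (_ \in _).
Qed.

(** Induction on [t]: cut [S] along a direction [i] in which some vertex of [S] has its neighbour in
    [S]. Both halves are nonempty, and each vertex loses at most one neighbour. *)
Lemma min_deg_card t S : S != set0 -> {in S, forall x, t <= deg S x} -> 2 ^ t <= #|S|.
Proof.
elim: t S => [|t IH] S /set0Pn[x xS] hS; first by rewrite card_gt0; apply/set0Pn; exists x.
have [i fi] : exists i, flip i x \in S.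
  have : 0 < deg S x by apply: leq_trans (hS _ xS).
  rewrite lt0n sum_nat_eq0 negb_forall => /existsP[i]; rewrite eqb0 negbK => h.
  by exists i.
have half (b : bool) : 2 ^ t <= #|S :&: [set y : cube d | y i == b]|.
  apply: IH.
    apply/set0Pn; case: (x i =P b) => [xb|xb].
      by exists x; rewrite !inE xS xb /=.
    exists (flip i x); rewrite !inE fi flip_id; move: xb.
    by case: (x i); case: b.
  move=> y; rewrite !inE => /andP[yS /eqP yb].
  rewrite -ltnS; apply: leq_trans (hS _ yS) _.
  rewrite /deg (bigD1 i) //= [in leqRHS](bigD1 i) //= -addSn leq_add //.
    by case: (_ \in _).
  apply: leq_sum => j ji; rewrite !inE flip_neq_id ?yb ?eqxx ?andbT //.
  by rewrite eq_sym.
rewrite -(cardsID [set y : cube d | y i == true] S) expnS mul2n -addnn leq_add ?(half true) //.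
apply: leq_trans (half false) _; apply: subset_leq_card; apply/subsetP => y.
by rewrite !inE; case: (y i); rewrite ?andbF ?andbT /=.
Qed.

(** Edge isoperimetry up to a constant factor. By [min_deg_card] a set this small contains a vertex
    of degree below [t]; deleting it lowers the degree sum by at most twice that degree. *)
Lemma sum_deg_le t S : #|S| < 2 ^ t -> \sum_(x in S) deg S x <= 2 * t * #|S|.
Proof.
elim: {S}#|S| {-2}S (erefl #|S|) => [|n IH] S cS lt.
  by move/eqP: cS; rewrite cards_eq0 => /eqP->; rewrite big_set0.
have [x xS dx] : exists2 x, x \in S & deg S x < t.
  apply/exists_inP; apply: contraLR lt => /exists_inPn h; rewrite -leqNgt cS.
  rewrite -cS; apply: min_deg_card; first by rewrite -cards_eq0 cS.
  by move=> x /h; rewrite -leqNgt.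
have cS' : #|S :\ x| = n by move: cS; rewrite (cardsD1 x) xS => -[].
have step : \sum_(y in S) deg S y <= 2 * deg S x + \sum_(y in S :\ x) deg (S :\ x) y.
  rewrite (big_setD1 x) //= mul2n -addnn -addnA leq_add2l.
  have e : S = [set x] :|: (S :\ x) by rewrite setD1K.
  apply: (@leq_trans (\sum_(y in S :\ x) (deg [set x] y + deg (S :\ x) y))).
    by apply: leq_sum => y _; rewrite {1}e degU.
  rewrite big_split leq_add2r sum_deg_sym big_set1; apply: degS.
  exact: subD1set.
have lt' : #|S :\ x| < 2 ^ t by apply: leq_ltn_trans lt; rewrite cS cS'.
have := IH _ cS' lt'; rewrite cS' in lt' *; rewrite cS; nia.
Qed.

Definition subcube D y := [set z : cube d | [forall j, (j \notin D) ==> (z j == y j)]].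

Definition sedges D y : {set {set cube d}} :=
  [set [set z; flip j z] | z in subcube D y, j in D].

Lemma mem_subcube D y : y \in subcube D y.
Proof. by rewrite inE; apply/forallP => j; rewrite eqxx implybT. Qed.

Lemma flip_subcube D y z j : j \in D -> z \in subcube D y -> flip j z \in subcube D y.
Proof.
move=> jD; rewrite !inE => /forallP h; apply/forallP => k; apply/implyP => kD.
rewrite flip_neq_id; first by have /implyP/(_ kD) := h k.
by apply: contraNneq kD => ->.
Qed.

Lemma sedges_sub D y : sedges D y \subset qedges d.
Proof. by apply/subsetP => e /imset2P[z j _ _ ->]; apply: qedge_flip. Qed.

Lemma sedgesT y : sedges setT y = qedges d.
Proof.
apply/eqP; rewrite eqEsubset sedges_sub; apply/subsetP => e /qedgesP[x [i ->]].
by apply: imset2_f; rewrite ?inE //; apply/forallP => j; rewrite inE.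
Qed.

Lemma sedges_subcube D y e : e \in sedges D y -> e \subset subcube D y.
Proof.
move=> /imset2P[z j zs jD ->].
by rewrite subUset !sub1set zs flip_subcube.
Qed.

(** A boundary edge has a single endpoint in [C], so it determines the pair of that endpoint and the
    direction. *)
Lemma out_pairs_le (E : {set {set cube d}}) D C :
  (forall z j, z \in C -> j \in D -> [set z; flip j z] \in E) ->
  \sum_(z in C) \sum_(j in D) (flip j z \notin C) <= #|eboundary E C|.
Proof.
move=> hE; rewrite pair_big /=.
rewrite (_ : \sum_(p | _) _ = #|[set p : cube d * 'I_d | [&& p.1 \in C, p.2 \in D & flip p.2 p.1 \notin C]]|).
  rewrite -(@card_in_imset _ _ (fun p : cube d * 'I_d => [set p.1; flip p.2 p.1])).
    apply: subset_leq_card; apply/subsetP => e /imsetP[[z j]]; rewrite !inE /=.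
    move=> /and3P[zC jD fC] ->; rewrite hE //=.
    rewrite (_ : _ :&: _ = [set z]) ?cards1 //; apply/setP => u; rewrite !inE.
    case: (u =P z) => [->|_] /=; first by rewrite zC.
    by case: (u =P _) => [->|//]; rewrite (negbTE fC).
  move=> [z j] [z' j']; rewrite !inE /= => /and3P[zC _ fC] /and3P[zC' _ fC'] e.
  have nz : z != flip j z by rewrite eq_sym flip_neq.
  case: (set2_eq nz e) => -[h1 h2]; last by rewrite -h1 zC in fC'.
  by subst z'; rewrite (flip_inj h2).
rewrite -sum1_card big_mkcond [RHS]big_mkcond /=; apply: eq_bigr => -[z j] _ /=.
by rewrite inE /=; case: (_ \in C); case: (_ \in D); case: (_ \in C).
Qed.

(** Each vertex of [C] has [#|D|] edges in the subcube, and [sum_deg_le] bounds how many of them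
    stay inside [C]. *)
Lemma eboundary_sedges D y C t : C \subset subcube D y -> #|C| < 2 ^ t ->
  #|C| * (#|D| - 2 * t) <= #|eboundary (sedges D y) C|.
Proof.
move=> Cs lt; apply: leq_trans (out_pairs_le (D := D) _); last first.
  by move=> z j zC jD; apply: imset2_f => //; apply: (subsetP Cs).
have h : #|C| * #|D| <= \sum_(z in C) \sum_(j in D) (flip j z \notin C) + \sum_(z in C) deg C z.
  rewrite -big_split /= -sum_nat_const; apply: leq_sum => z _.
  apply: (@leq_trans (\sum_(j in D) (flip j z \notin C) + \sum_(j in D) (flip j z \in C))).
    rewrite -big_split /= -sum1_card; apply: leq_sum => j _.
    by case: (_ \in C).
  rewrite leq_add2l /deg big_mkcond; apply: leq_sum => j _.
  by case: ifP.
by have := sum_deg_le lt; nia.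
Qed.

(** The [k]-th vertex on the path from [p.1] to [p.2] that corrects the coordinates in increasing
    order. *)
Definition hybrid (k : nat) (p : cube d * cube d) : cube d :=
  [ffun j : 'I_d => if j < k then p.2 j else p.1 j].

(** Exchanging the first [k] coordinates of two points is an involution; hence [hybrid k] of a
    uniform pair is uniform. *)
Lemma hybrid_bij k : bijective (fun p => (hybrid k p, hybrid k (p.2, p.1))).
Proof.
exists (fun p => (hybrid k p, hybrid k (p.2, p.1))) => -[x y] /=;
  by congr (_, _); apply/ffunP => j; rewrite !ffunE /= ?ffunE /=; case: (j < _).
Qed.

(* Replacing the coordinates of x by those of y one at a time gives a path from x to y;
   each step of these paths is uniformly distributed over the cube. *)
Lemma cube_poincare X :
  #|X| * #|~: X| <= 2 ^ d * \sum_(x in X) deg (~: X) x.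
Proof.
pose g i (u : cube d) : nat := (u \in X) && (flip i u \notin X).
have eR : \sum_(x in X) deg (~: X) x = \sum_(i < d) \sum_u g i u.
  rewrite /deg exchange_big; apply: eq_bigr => i _ /=; rewrite big_mkcond.
  by apply: eq_bigr => u _; rewrite /g inE; case: (u \in X).
(* By [hybrid_bij] each vertex [u] is the [i]-th path vertex of exactly [2 ^ d] pairs. *)
have eq1 i : 2 ^ d * \sum_u g i u = \sum_(p : cube d * cube d) g i (hybrid i p).
  rewrite (reindex _ (onW_bij _ (hybrid_bij i))) /=.
  have hh p : hybrid i (hybrid i p, hybrid i (p.2, p.1)) = p.1.
    by apply/ffunP => j; rewrite !ffunE /= ?ffunE /=; case: (j < _).
  under [RHS]eq_bigr => p _ do rewrite hh.
  rewrite -(pair_bigA _ (fun x y : cube d => g i x)) /= big_distrr.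
  apply: eq_bigr => u _; rewrite sum_nat_const -card_cube; congr (_ * _).
  by apply: eq_card => z; rewrite inE.
rewrite eR big_distrr /=; under eq_bigr => i _ do rewrite eq1.
rewrite exchange_big /= -cardsX -sum1_card big_mkcond.
apply: leq_sum => -[x y] _; case: ifP => //; rewrite !inE /= => /andP[xX yX].
have h0 : hybrid 0 (x, y) = x by apply/ffunP => j; rewrite ffunE.
have hd : hybrid d (x, y) = y by apply/ffunP => j; rewrite ffunE ltn_ord.
(* The path starts in [X] and ends outside, so a first vertex outside [X] exists; the step into it
   must flip coordinate [k]. *)
have [k kd /andP[k1 k2]] : exists2 k, k < d & (hybrid k (x, y) \in X) && (hybrid k.+1 (x, y) \notin X).
  have ex : exists k, hybrid k (x, y) \notin X by exists d; rewrite hd.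
  case: (ex_minnP ex) => -[|k] hk kmin; first by rewrite h0 xX in hk.
  exists k; last by rewrite hk andbT; apply: contraT => /kmin; rewrite ltnn.
  by apply: kmin; rewrite hd.
rewrite (bigD1 (Ordinal kd)) //= (leq_trans _ (leq_addr _ _)) // lt0b /g k1 /=.
have [e|e] : hybrid k.+1 (x, y) = hybrid k (x, y) \/
       hybrid k.+1 (x, y) = flip (Ordinal kd) (hybrid k (x, y)).
- case: (x (Ordinal kd) =P y (Ordinal kd)) => xy; [left|right]; apply/ffunP => j.
    rewrite !ffunE /= ltnS leq_eqVlt; case: ltngtP => //= jk.
    by rewrite (_ : j = Ordinal kd) ?xy //; apply: val_inj.
  rewrite !ffunE /= ltnS leq_eqVlt -val_eqE /=; case: ltngtP => //= jk; rewrite ?addbF ?addbT //.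
  rewrite (_ : j = Ordinal kd); last exact: val_inj.
  by move: xy; case: (x _); case: (y _).
- by rewrite e k1 in k2.
- by rewrite -e.
Qed.

End Hypercube.

(** * Exploration of a component *)

Section Components.
Local Open Scope nat_scope.
Variable d : nat.
Implicit Types (x y : cube d) (G E : {set {set cube d}}) (C S : {set cube d}).

Lemma gcomp_refl G x : x \in gcomp G x.
Proof. by rewrite inE connect0. Qed.

Lemma gcomp_step G x u v : u \in gcomp G x -> [set u; v] \in G -> v \in gcomp G x.
Proof. by rewrite !inE => xu uv; apply: connect_trans xu (connect1 _). Qed.

Lemma gcomp_closed G x C : x \in C ->
  (forall u v, u \in C -> [set u; v] \in G -> v \in C) -> gcomp G x \subset C.
Proof.
move=> xC hC; apply/subsetP => y; rewrite inE => /connectP[r + ->].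
elim: r x xC => [|z r IH] x xC //= /andP[xz]; apply: IH.
exact: hC xz.
Qed.

Lemma gcompS G (H : {set {set cube d}}) x : G \subset H -> gcomp G x \subset gcomp H x.
Proof.
move=> GH; apply: gcomp_closed; first exact: gcomp_refl.
by move=> u v uC /(subsetP GH); apply: gcomp_step.
Qed.

Lemma gcomp_eq G x y : y \in gcomp G x -> gcomp G y = gcomp G x.
Proof.
have sym : connect_sym (Defs.grel G) by apply: sym_connect_sym => u v; rewrite /Defs.grel setUC.
rewrite inE => xy; apply/setP => z; rewrite !inE.
by rewrite (same_connect sym xy).
Qed.

Lemma eboundaryP E C e : E \subset qedges d ->
  reflect (exists u v, [/\ u \in C, v \notin C, e = [set u; v] & e \in E]) (e \in eboundary E C).
Proof.
move=> Eq; rewrite inE; apply: (iffP andP) => [[eE /cards1P[u ue]]|[u [v [uC vC -> eE]]]].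
  have /qedgesP[z [i ez]] := subsetP Eq _ eE.
  have nz : z != flip i z by rewrite eq_sym flip_neq.
  have huv w : (w \in C) && ((w == z) || (w == flip i z)) = (w == u).
    by move/setP/(_ w): ue; rewrite ez !inE andbC.
  have := huv z; have := huv (flip i z); rewrite !eqxx /= orbT !andbT.
  case: (z =P u) => [zu|_] h1 h2.
    exists z, (flip i z); rewrite h1 h2; split => //.
    by rewrite -zu eq_sym.
  exists (flip i z), z; rewrite h1 h2 setUC; split => //.
  have := huv u; rewrite eqxx => /andP[uC /orP[/eqP uz|/eqP->]] //.
  by rewrite -uz uC in h2.
split => //; rewrite (_ : _ :&: C = [set u]) ?cards1 //.
apply/setP => w; rewrite !inE; case: (w =P u) => [->|_] /=; first exact: uC.
by case: (w =P v) => // ->; apply: negbTE.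
Qed.

Lemma eboundaryS G (H : {set {set cube d}}) C : G \subset H -> eboundary G C \subset eboundary H C.
Proof. by move=> GH; apply/subsetP => e; rewrite !inE => /andP[/(subsetP GH)->]. Qed.

End Components.

Section Exploration.
Variables (R : realType) (d : nat) (p rho : R) (E : {set {set cube d}}) (x : cube d).
Variables (K D0 : nat).
Hypotheses (p0 : 0 <= p) (p1 : p < 1) (rho0 : 0 < rho) (rho1 : rho <= 1).
Hypothesis E_edges : E \subset qedges d.
Hypothesis expand : forall O : {set {set cube d}}, O \subset E ->
  (#|gcomp O x| < K)%N -> (#|gcomp O x| * D0 <= #|eboundary E (gcomp O x)|)%N.

(** Likelihood ratio of a closed edge when the density [p] is replaced by [rho * p]; for an open
    edge the ratio is [rho]. *)
Let r2 := (1 - rho * p) / (1 - p).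
(** Lower bound for the likelihood ratio after exploring a component of [m < K] vertices: [m - 1]
    edges were found open and at least [m * D0] closed. *)
Let psi (m : nat) : R := if (m < K)%N then rho ^+ m.-1 * r2 ^+ (m * D0) else 0.

Lemma explore_r2_ge1 : 1 <= r2.
Proof. by rewrite /r2 ler_pdivlMr ?subr_gt0 // mul1r lerD2l lerN2 ler_piMl. Qed.

(* The component of x is explored edge by edge; the edges of O were found open, those
   outside O and U were found closed. The right-hand side is the likelihood of these
   answers under the density rho * p, relative to the density p. *)
Lemma explore (U O : {set {set cube d}}) (C : {set cube d}) :
  [disjoint O & U] -> O \subset E -> U \subset E -> x \in C -> #|C| = #|O|.+1 ->
  (forall e, e \in O -> e \subset C) -> C \subset gcomp O x ->
  bern p U (fun G => psi #|gcomp (O :|: G) x|)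
    <= rho ^+ #|O| * r2 ^+ #|E :\: (O :|: U)|.
Proof.
have r21 := explore_r2_ge1.
have r20 : 0 <= r2 by apply: le_trans r21.
have [n] := ubnP #|U|; elim: n U O C => // n IH U O C /ltnSE cU dis OE UE xC cC OC CO.
have gO : gcomp O x = C.
  apply/eqP; rewrite eqEsubset CO andbT; apply: gcomp_closed => // u v uC /OC.
  by rewrite subUset !sub1set => /andP[].
have Uq : U \subset qedges d by apply: subset_trans UE E_edges.
(* If no unqueried edge leaves [C], then [C] is the component and all its boundary edges in [E] were
   found closed; [expand] counts them. Otherwise query one edge [e] that leaves [C]. *)
have [bU|[e]] := set_0Vmem (eboundary U C).
  have nU u v : u \in C -> v \notin C -> [set u; v] \notin U.
    move=> uC vC; apply/negP => uvU; have := in_set0 [set u; v].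
    by rewrite -bU => /negP[]; apply/eboundaryP => //; exists u, v.
  have gC (G : {set {set cube d}}) : G \subset U -> gcomp (O :|: G) x = C.
    move=> GU; apply/eqP; rewrite eqEsubset (subset_trans CO) ?gcompS ?subsetUl // andbT.
    apply: gcomp_closed => // u v uC; rewrite inE => /orP[/OC|/(subsetP GU) uvU].
      by rewrite subUset !sub1set => /andP[].
    by apply: contraLR uvU; apply: nU.
  rewrite (_ : bern _ _ _ = psi #|C|); last first.
    by rewrite -(bern_cst p U (psi _)); apply: eq_bern => G /gC->.
  rewrite /psi; case: ifP => [cK|_]; last by rewrite mulr_ge0 ?exprn_ge0 // ltW.
  rewrite cC /= -cC; apply: ler_wpM2l; first by rewrite exprn_ge0 // ltW.
  apply: ler_weXn2l => //; rewrite -gO in cK *; apply: leq_trans (expand OE cK) _.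
  apply: subset_leq_card; apply/subsetP => e; rewrite gO => /(eboundaryP _ _ E_edges).
  move=> [u [v [uC vC -> eE]]]; rewrite in_setD eE andbT inE negb_or nU // andbT.
  by apply: contra vC => /OC; rewrite subUset !sub1set => /andP[].
move=> /(eboundaryP _ _ Uq)[u [v [uC vC ee eU]]].
have cU' : (#|U :\ e| < n)%N by move: cU; rewrite (cardsD1 e) eU.
have eO : e \notin O by rewrite (disjointFl dis eU).
have U'E : U :\ e \subset E by apply: subset_trans UE; apply: subsetDl.
rewrite (bern_step p _ eU).
have IH1 : bern p (U :\ e) (fun G => psi #|gcomp (O :|: (e |: G)) x|)
   <= rho ^+ #|O|.+1 * r2 ^+ #|E :\: (O :|: U)|.
  have cO : #|e |: O| = #|O|.+1 by rewrite cardsU1 eO.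
  have eUU : (e |: O) :|: (U :\ e) = O :|: U by rewrite -setUA setUCA setD1K.
  rewrite -cO -eUU.
  under eq_bern => G _ do rewrite setUCA setUA.
  apply: (IH _ (e |: O) (v |: C) cU') => //.
  - rewrite -setI_eq0; apply/eqP/setP => f; rewrite !inE.
    case: eqP => //= _; case fO: (f \in O) => //=; by rewrite (disjointFr dis fO).
  - by rewrite subUset OE sub1set (subsetP UE).
  - by rewrite inE xC orbT.
  - by rewrite cO cardsU1 vC cC.
  - move=> f; rewrite inE => /orP[/set1P->|/OC fC].
      by rewrite ee subUset !sub1set !inE uC eqxx orbT.
    by apply: subset_trans fC _; apply: subsetUr.
  - rewrite subUset sub1set; apply/andP; split; last first.
      by apply: subset_trans CO _; apply: gcompS; apply: subsetUr.
    apply: (@gcomp_step _ _ _ u); last by rewrite -ee !inE eqxx.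
    by apply: (subsetP (gcompS _ (subsetUr _ _))); apply: (subsetP CO).
have IH2 : bern p (U :\ e) (fun G => psi #|gcomp (O :|: G) x|)
   <= rho ^+ #|O| * r2 ^+ #|E :\: (O :|: U)|.+1.
  have -> : (#|E :\: (O :|: U)|.+1 = #|E :\: (O :|: (U :\ e))|)%N.
    have eEU : e \in E :\: (O :|: U :\ e) by rewrite !inE eqxx (negbTE eO) (subsetP UE).
    rewrite [RHS](cardsD1 e) eEU add1n; congr (#|pred_of_set _|.+1).
    apply/setP => f; rewrite !inE; case: (f =P e) => [->|] //=.
    by rewrite eU orbT.
  apply: (IH _ O C cU') => //.
  by apply: disjointWr dis; apply: subsetDl.
(* A query preserves the expected likelihood ratio, because [p rho + (1 - p) r2 = 1]. *)
have -> : rho ^+ #|O| * r2 ^+ #|E :\: (O :|: U)|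
   = p * (rho ^+ #|O|.+1 * r2 ^+ #|E :\: (O :|: U)|)
   + (1 - p) * (rho ^+ #|O| * r2 ^+ #|E :\: (O :|: U)|.+1).
  rewrite !exprS /r2; move: (_ ^+ _) (_ ^+ _) => a b; field.
  by rewrite subr_eq0 gt_eqF.
apply: lerD; apply: ler_wpM2l => //; by rewrite subr_ge0 ltW.
Qed.

(** [explore] started from the single vertex [x] bounds the expectation of [psi] by 1, and
    [theta ^+ m <= rho * psi m] for [0 < m < K] because [r2 ^+ D0 >= 1 + (1 - rho) p D0]. Some
    [theta > 1] is admissible for [rho] near 1 when [p D0 > 1]: this is where supercriticality
    enters. *)
Lemma small_component_moment (theta : R) : 0 <= theta ->
  theta <= rho * (1 + (1 - rho) * (p * D0%:R)) ->
  bern p E (fun G => if (#|gcomp G x| < K)%N then theta ^+ #|gcomp G x| else 0) <= rho.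
Proof.
move=> th0 hth; have r21 := explore_r2_ge1.
have r20 : 0 <= r2 by apply: le_trans r21.
have hr2 : 1 + (1 - rho) * p <= r2.
  rewrite /r2 ler_pdivlMr ?subr_gt0 //; have r10 : 0 <= 1 - rho by rewrite subr_ge0.
  have := mulr_ge0 r10 (mulr_ge0 p0 p0); nra.
have hrD : 1 + (1 - rho) * (p * D0%:R) <= r2 ^+ D0.
  have b0 : 0 <= (1 - rho) * p by rewrite mulr_ge0 // subr_ge0.
  apply: le_trans (_ : (1 + (1 - rho) * p) ^+ D0 <= _); last first.
    by apply: lerXn2r; rewrite ?nnegrE // addr_ge0.
  rewrite mulrA; elim: (D0) => [|m IH]; first by rewrite mulr0 addr0.
  rewrite exprS; apply: (@le_trans _ _ ((1 + (1 - rho) * p) * (1 + (1 - rho) * p * m%:R))).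
    rewrite -(natr1 m); have := mulr_ge0 b0 (mulr_ge0 b0 (ler0n R m)).
    by move: ((1 - rho) * p) b0 => b b0; nra.
  by apply: ler_wpM2l => //; rewrite addr_ge0.
have hth' : theta <= rho * r2 ^+ D0.
  by apply: le_trans hth _; apply: ler_wpM2l hrD; apply: ltW.
have start : bern p E (fun G => psi #|gcomp (set0 :|: G) x|) <= 1.
  apply: le_trans (@explore E set0 [set x] _ _ _ _ _ _ _) _ => //.
  - by rewrite -setI_eq0 set0I.
  - exact: sub0set.
  - by rewrite inE.
  - by rewrite cards1 cards0.
  - by move=> e; rewrite inE.
  - by rewrite sub1set gcomp_refl.
  - by rewrite cards0 expr0 mul1r set0U setDv cards0.
rewrite -[leRHS]mulr1; apply: le_trans (ler_wpM2l (ltW rho0) start).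
rewrite -bernZ; apply: ler_bern; first by rewrite p0 ltW.
move=> G GE; rewrite set0U /psi; case: ifP => cK; last by rewrite mulr0.
have : (0 < #|gcomp G x|)%N by apply/card_gt0P; exists x; apply: gcomp_refl.
case: #|_| => // m _ /=.
rewrite mulrA -exprS mulnC exprM -exprMn.
by apply: lerXn2r; rewrite ?nnegrE // mulr_ge0 ?exprn_ge0 // ltW.
Qed.

End Exploration.

(** * Components of size at least K *)

Lemma bern_restrict (R : realType) (T : finType) (p : R) (E F : {set T}) (f : {set T} -> R) :
  F \subset E -> bern p E (fun G => f (G :&: F)) = bern p F f.
Proof.
move=> /setIidPr; rewrite setIC => {2}<-.
elim/set_ind_D1: E f => [|E e eE IH] f; first by rewrite setI0 !bern0 set0I.
rewrite (bern_step p _ eE) IH; have [eF|eF] := boolP (e \in F).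
  rewrite [RHS](bern_step p f (e := e)) ?inE ?eF // setIDA.
  congr (_ * _ + _); rewrite -setIDA -(IH (fun H => f (e |: H))); apply: eq_bern => G _.
  by rewrite setIUl (setIidPl _) // sub1set.
have -> : F :&: (E :\ e) = F :&: E.
  by apply/setP => z; rewrite !inE; case: (z =P e) => // ->; rewrite (negbTE eF).
rewrite (_ : bern p _ _ = bern p (F :&: E) f); first by ring.
rewrite -[in RHS](_ : F :&: (E :\ e) = F :&: E) -?IH; last first.
  by apply/setP => z; rewrite !inE; case: (z =P e) => // ->; rewrite (negbTE eF).
apply: eq_bern => G _; congr f; apply/setP => z; rewrite !inE.
by case: (z =P e) => // ->; rewrite (negbTE eF) !andbF.
Qed.

Section BigComponents.
Variables (R : realType) (d : nat) (p s theta : R) (K t : nat).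
Hypotheses (p0 : 0 <= p) (p1 : p < 1) (s0 : 0 <= s) (s1 : s < 1).
Hypotheses (theta1 : 1 <= theta) (Kt : (K <= 2 ^ t)%N).
Implicit Types (x y : cube d) (G : {set {set cube d}}).

Let hp : 0 <= p <= 1. Proof. by rewrite p0 ltW. Qed.

Definition bigset G := [set x : cube d | (K <= #|gcomp G x|)%N].

(** The component of [y] cannot leave the subcube, and below [K <= 2 ^ t] vertices it expands by
    [eboundary_sedges] with [D0 = #|D| - 2 * t]; the tilt is [rho = 1 - s]. *)
Lemma small_component_subcube (D : {set 'I_d}) y :
  theta <= (1 - s) * (1 + s * (p * (#|D| - 2 * t)%:R)) ->
  bern p (sedges D y)
    (fun G => if (#|gcomp G y| < K)%N then theta ^+ #|gcomp G y| else 0) <= 1 - s.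
Proof.
move=> hth; apply: (@small_component_moment _ _ p (1 - s) _ _ _ (#|D| - 2 * t)) => //.
- by rewrite subr_gt0.
- by rewrite lerBlDr lerDl.
- exact: sedges_sub.
- move=> O OE cK; apply: eboundary_sedges; last exact: leq_trans cK Kt.
  apply: gcomp_closed; first exact: mem_subcube.
  move=> u v _ /(subsetP OE)/sedges_subcube; rewrite subUset !sub1set.
  by move=> /andP[].
- exact: le_trans theta1.
- by rewrite subKr.
Qed.

(** As [theta >= 1], the truncated moment dominates the probability that the component has fewer
    than [K] vertices. *)
Lemma big_component_subcube (D : {set 'I_d}) y :
  theta <= (1 - s) * (1 + s * (p * (#|D| - 2 * t)%:R)) ->
  s <= bern p (sedges D y) (fun G => (K <= #|gcomp G y|)%N%:R).
Proof.
move=> hth; have := small_component_subcube y hth.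
rewrite -[in s <= _](subKr 1 s) lerBlDr -lerBlDl => h.
apply: le_trans h; rewrite -[X in X - _](bern_cst p (sedges D y)) -bernB.
apply: ler_bern => // G _; rewrite leqNgt; case: ifP => _ /=; last by rewrite subrr.
by rewrite subr0 exprn_ege1.
Qed.

(** Markov's inequality for the truncated moment, taken in the whole cube. *)
Lemma medium_component k x :
  theta <= (1 - s) * (1 + s * (p * (d - 2 * t)%:R)) ->
  bern p (qedges d) (fun G => (k <= #|gcomp G x| < K)%N%:R) <= theta ^- k.
Proof.
move=> hth; have th0 : 0 < theta by apply: lt_le_trans theta1.
have hth' : theta <= (1 - s) * (1 + s * (p * (#|[set: 'I_d]| - 2 * t)%:R)).
  by rewrite cardsT card_ord.
have := small_component_subcube x hth'; rewrite sedgesT => h.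
have {h} h : bern p (qedges d) (fun G => if (#|gcomp G x| < K)%N then theta ^+ #|gcomp G x| else 0) <= 1.
  by apply: le_trans h _; rewrite lerBlDr lerDl.
rewrite -[leRHS]mulr1; apply: (@le_trans _ _ _ _ _ _ (ler_wpM2l _ h)); last first.
  by rewrite invr_ge0 exprn_ge0 // ltW.
rewrite -bernZ; apply: ler_bern => // G _.
case: ifP => cK; last by rewrite mulr0 andbF.
rewrite andbT; case: leqP => kc; last by rewrite mulr_ge0 ?invr_ge0 ?exprn_ge0 // ltW.
by rewrite mulrC ler_pdivlMr ?exprn_gt0 // mul1r ler_weXn2l.
Qed.

(** The two subcubes differ in coordinate [i], which is frozen in both. *)
Lemma disjoint_sedges (D : {set 'I_d}) x i j : i \notin D -> i != j ->
  [disjoint sedges D (flip i x) & sedges D (flip j x)].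
Proof.
move=> iD ij; rewrite -setI_eq0; apply/eqP/setP => e; rewrite !inE.
apply/negP => /andP[/imset2P[z k zs _ ->] /sedges_subcube]; rewrite subUset !sub1set => /andP[zs' _].
move: zs zs'; rewrite !inE => /forallP/(_ i) + /forallP/(_ i); rewrite iD /= => /eqP->.
by rewrite flip_id flip_neq_id //; case: (x i).
Qed.

(** The neighbours of [x] in the directions of [D] lie in disjoint subcubes spanned by the
    directions outside [D]. Being big within one's own subcube has probability at least [s],
    independently for these neighbours, and implies membership in [bigset G]. *)
Lemma few_big_neighbours (D : {set 'I_d}) x :
  theta <= (1 - s) * (1 + s * (p * (d - #|D| - 2 * t)%:R)) ->
  bern p (qedges d) (fun G => ((deg (bigset G) x)%:R < s * #|D|%:R / 4)%R%:R)
    <= expR (- (s * #|D|%:R / 4)).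
Proof.
move=> hth; pose F i := sedges (~: D) (flip i x).
pose a i (G : {set {set cube d}}) := (K <= #|gcomp (G :&: F i) (flip i x)|)%N.
have cD : #|~: D| = (d - #|D|)%N by rewrite cardsCs setCK card_ord.
apply: le_trans (_ : bern p (qedges d) (fun G =>
    (\sum_(i in D) 1 * (a i G)%:R < s * #|D|%:R / 4)%R%:R) <= _).
  apply: ler_bern => // G _; case: ltP => // hG.
  rewrite (_ : (_ < _)%R = true) //; apply: le_lt_trans hG.
  rewrite /deg natr_sum big_mkcond; apply: ler_sum => i _; rewrite mul1r.
  case: ifP => // _; rewrite ler_nat inE; case: (boolP (a i G)) => // h.
  rewrite lt0b (leq_trans h) //; apply: subset_leq_card; apply: gcompS.
  exact: subsetIl.
apply: (bern_chernoff (F := F)) => //.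
- by move=> i G _; rewrite /a -setIA setIid.
- by move=> i j iD jD; apply: disjoint_sedges; rewrite inE iD.
- move=> i iD; rewrite (bern_restrict p (fun G => (K <= #|gcomp G (flip i x)|)%N%:R)) ?sedges_sub //.
  by apply: big_component_subcube; rewrite cD.
- by move=> i _; rewrite ler01 lexx.
- by rewrite -sumr_const.
Qed.

End BigComponents.

(** * Covering a graph by short connected pieces *)

Section Chunks.
Local Open Scope nat_scope.
Variable d : nat.
Implicit Types (x y u v : cube d) (G T : {set {set cube d}}) (C S X : {set cube d}).
Implicit Types (w : seq (cube d)).

Fixpoint changes S w : nat :=
  if w is x :: w' then
    (if w' is y :: _ then (x \in S) (+) (y \in S) : nat else 0) + changes S w'
  else 0.

Definition mono S w := all (mem S) w || all [predC mem S] w.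

Lemma changes_rcons S w1 u w2 :
  changes S (w1 ++ u :: w2) = changes S (rcons w1 u) + changes S (u :: w2).
Proof.
elim: w1 => [|x w1 IH] //; rewrite cat_cons rcons_cons.
have step a (b : cube d) : changes S (x :: a) = (if a is y :: _ then (x \in S) (+) (y \in S) : nat else 0) + changes S a by [].
rewrite !step // IH addnA; congr (_ + _ + _).
by case: w1 {IH}.
Qed.

Lemma changes_cat S w1 w2 : changes S w1 + changes S w2 <= changes S (w1 ++ w2).
Proof.
case: w2 => [|u w2]; first by rewrite addn0 cats0.
rewrite changes_rcons leq_add2r; elim: w1 => [|x w1 IH] //.
rewrite rcons_cons /=; apply: leq_add => //.
by case: w1 {IH}.
Qed.

Lemma changes0_mono S w : changes S w = 0 -> mono S w.
Proof.
case: w => [|x w] //= e.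
have {e} : all (fun y => (y \in S) == (x \in S)) w.
  elim: w x e => [|y w IH] x //= /eqP; rewrite addn_eq0 => /andP[xy /eqP/IH h].
  have exy : (y \in S) = (x \in S) by move: xy; do 2 case: (_ \in S).
  by rewrite exy eqxx /=; apply: sub_all h => z /=; rewrite exy.
rewrite /mono /=; case: (x \in S) => /= h; rewrite ?orbF;
  by apply: sub_all h => z /= /eqP; rewrite ?inE => ->.
Qed.

(** The pieces are disjoint stretches of the walk, so each piece meeting both [S] and its complement
    uses up a change of its own. Only the last piece may be shorter than [K], whence the extra
    [K]. *)
Lemma chop_walk K w : 0 < K -> exists cs : seq (seq (cube d)),
  [/\ flatten cs = w, all (fun c => size c <= K) cs,
      size cs * K <= size w + K
    & forall S, count (predC (mono S)) cs <= changes S w].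
Proof.
move=> K0; have [n] := ubnP (size w); elim: n w => // n IH w /ltnSE szw.
have one S w' : ~~ mono S w' <= changes S w'.
  by case: (boolP (mono S w')) => //= h; rewrite lt0n; apply: contra h => /eqP/changes0_mono.
case: (leqP (size w) K) => wK.
  exists [:: w]; split; rewrite /= ?cats0 ?wK ?mul1n ?leq_addl //.
  by move=> S; rewrite addn0 one.
have [|cs [fl sz ct hS]] := IH (drop K w); first by rewrite size_drop; lia.
exists (take K w :: cs); split => /=.
- by rewrite fl cat_take_drop.
- by rewrite size_take wK leqnn.
- move: ct; rewrite size_drop subnK ?(ltnW wK) // => ct.
  by rewrite mulSn addnC leq_add2r.
move=> S; rewrite -{2}(cat_take_drop K w); apply: leq_trans (changes_cat _ _ _).
by apply: leq_add => //; apply: one.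
Qed.

Lemma card_pair_cut u v S : u != v ->
  (#|[set u; v] :&: S| == 1) = (u \in S) (+) (v \in S).
Proof.
move=> uv; have -> : #|[set u; v] :&: S| = (u \in S) + (v \in S).
  rewrite setIUl cardsU.
  have -> : [set u] :&: S :&: ([set v] :&: S) = set0.
    apply/setP => z; rewrite !inE; case: (z =P u) => [->|] //=.
    by rewrite (negbTE uv) andbF.
  have c1 z : #|[set z] :&: S| = (z \in S).
    case: (boolP (z \in S)) => zS; last by rewrite disjoint_setI0 ?cards0 ?disjoints1.
    by rewrite (setIidPl _) ?cards1 // sub1set.
  by rewrite cards0 subn0 !c1.
by case: (u \in S); case: (v \in S).
Qed.

(* The walk goes around a growing subtree T of the component: a new leaf v hung at u
   replaces an occurrence of u by u, v, u. *)
Lemma covering_walk G x n : n < #|gcomp G x| -> exists X w T,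
  [/\ #|X| = n.+1, X \subset gcomp G x, x \in X, w =i X & size w = n.*2.+1] /\
  [/\ T \subset G, forall e, e \in T -> e \subset X
    & forall S, changes S w = 2 * #|eboundary T S|].
Proof.
elim: n => [|n IH] ltn.
  exists [set x], [:: x], set0; split; split => //.
  - by rewrite cards1.
  - by rewrite sub1set gcomp_refl.
  - by rewrite inE.
  - by move=> z; rewrite !inE.
  - exact: sub0set.
  - by move=> e; rewrite inE.
  - move=> S; rewrite (_ : eboundary _ _ = set0) ?cards0 //.
    by apply/setP => e; rewrite !inE.
have [X [w [T [[cX XC xX wX sw] [TG TX hT]]]]] := IH (ltnW ltn).
(* As [X] is smaller than the component, it is not closed under adjacency, so some edge of [G]
   leaves it. *)
have [u uX [v vX uvG]] : exists2 u, u \in X & exists2 v, v \notin X & [set u; v] \in G.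
  have : ~~ (gcomp G x \subset X).
    by apply/negP => /subset_leq_card; rewrite cX leqNgt ltn.
  move=> h; have [/exists_inP[u uX /exists_inP[v vX uvG]]|] :=
    boolP [exists u in X, exists v in ~: X, [set u; v] \in G].
    by exists u => //; exists v => //; move: vX; rewrite inE.
  move=> /exists_inPn no; case/negP: h; apply: gcomp_closed => // u v uX uvG.
  apply: contraT => vX; have /exists_inPn/(_ v) := no _ uX.
  by rewrite inE vX uvG => /(_ isT).
have uv : u != v by apply: contraNneq vX => <-.
have uw : u \in w by rewrite wX.
have [w1 [w2 ew]] : exists w1 w2, w = w1 ++ u :: w2.
  by case/splitPr: uw => w1 w2; exists w1, w2.
exists (v |: X), (w1 ++ u :: v :: u :: w2), ([set u; v] |: T); split; split.
- by rewrite cardsU1 vX cX.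
- rewrite subUset XC andbT sub1set; apply: gcomp_step uvG.
  exact: (subsetP XC).
- by rewrite inE xX orbT.
- move=> z; have := wX z; rewrite ew !(inE, mem_cat) => <-.
  by case: (z == u); case: (z == v); rewrite ?orbT.
- by move: sw; rewrite ew !size_cat /= !addnS doubleS => ->.
- by rewrite subUset TG sub1set uvG.
- move=> e; rewrite inE => /orP[/set1P->|/TX h].
    by rewrite subUset !sub1set !inE uX eqxx orbT.
  by apply: subset_trans h (subsetUr _ _).
move=> S; have uvT : [set u; v] \notin T.
  by apply: contra vX => /TX; rewrite subUset !sub1set => /andP[].
have := hT S; rewrite ew !changes_rcons.
(* The detour traverses the edge [uv] twice, which gives the factor 2 in front of the tree
   boundary. *)
have -> : changes S (u :: v :: u :: w2) = 2 * ((u \in S) (+) (v \in S)) + changes S (u :: w2).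
  by rewrite mul2n -addnn -addnA [in RHS]/= {2}addbC.
have -> : #|eboundary ([set u; v] |: T) S| = ((u \in S) (+) (v \in S)) + #|eboundary T S|.
  rewrite -(card_pair_cut S uv) -(cardsID [set [set u; v]] (eboundary _ S)); congr (_ + _).
    case: (boolP (#|_| == 1)) => h.
      rewrite (_ : _ :&: _ = [set [set u; v]]) ?cards1 //.
      by apply/setP => e; rewrite !inE; case: eqP => [->|]; rewrite ?h ?andbF.
    rewrite (_ : _ :&: _ = set0) ?cards0 //.
    by apply/setP => e; rewrite !inE; case: eqP => [->|]; rewrite ?(negbTE h) ?andbF.
  apply: eq_card => e; rewrite !inE; case: eqP => [->|] //=.
  by rewrite (negbTE uvT).
by move=> h; rewrite mulnDr -h addnCA.
Qed.

(** Chop the covering walk of every component [C] with at least [K] vertices. The walk has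
    [2 #|C| - 1] entries and [K <= #|C|], so the number of pieces times [K] is at most [3 #|C|]; its
    changes are twice the boundary edges of a spanning tree. *)
Lemma bigset_chunks G K : 0 < K -> exists cs : seq (seq (cube d)),
  [/\ forall x, x \in bigset K G -> has (fun c => x \in c) cs,
      all (fun c => size c <= K) cs,
      size cs * K <= 3 * 2 ^ d
    & forall S, count (predC (mono S)) cs <= 2 * #|eboundary G S|].
Proof.
move=> K0; pose CC := [set gcomp G x | x in bigset K G].
have uniqC C z : C \in CC -> z \in C -> C = gcomp G z.
  by move=> /imsetP[x _ ->] /gcomp_eq.
(* Distinct components are disjoint, so in the sums over [CC] each vertex and each boundary edge is
   counted at most once. *)
suff [cs [h1 h2 h3 h4]] : exists cs : seq (seq (cube d)),
  [/\ forall x, x \in bigset K G -> has (fun c => x \in c) cs,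
      all (fun c => size c <= K) cs,
      size cs * K <= \sum_(C in CC) 3 * #|C|
    & forall S, count (predC (mono S)) cs
        <= \sum_(C in CC) 2 * #|eboundary [set e in G | e \subset C] S|].
  exists cs; split => //.
    apply: leq_trans h3 _; rewrite -big_distrr leq_mul2l /= -card_cube.
    rewrite (eq_bigr (fun C : {set cube d} => \sum_(z in [set: cube d]) (z \in C))); last first.
      by move=> C _; rewrite -sum1_card big_mkcond; apply: eq_big => // z; rewrite inE.
    rewrite exchange_big /= -sum1_card; apply: leq_sum => z _.
    rewrite -big_mkcondr /= -[leqRHS]/(1 : nat) sum1_card.
    apply/card_le1_eqP => C C'; rewrite !unfold_in => /andP[CC1 zC] /andP[CC2 zC'].
    by rewrite (uniqC _ _ CC1 zC) (uniqC _ _ CC2 zC').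
  move=> S; apply: leq_trans (h4 S) _; rewrite -big_distrr leq_mul2l /=.
  rewrite (eq_bigr (fun C : {set cube d} => \sum_(e in eboundary G S) (e \subset C))); last first.
    move=> C _; rewrite -sum1_card big_mkcond [RHS]big_mkcond; apply: eq_bigr => e _.
    by rewrite !inE; case: (e \in G); case: (e \subset C) => //=; case: ifP.
  rewrite exchange_big /= -sum1_card; apply: leq_sum => e.
  rewrite inE => /andP[_ /cards1P[z /setP/(_ z)]]; rewrite !inE eqxx => /andP[ze _].
  rewrite -big_mkcondr /= sum1_card.
  apply/card_le1_eqP => C C'; rewrite !unfold_in => /andP[CC1 zC] /andP[CC2 zC'].
  by rewrite (uniqC _ _ CC1 (subsetP zC _ ze)) (uniqC _ _ CC2 (subsetP zC' _ ze)).
suff [cs [h1 h2 h3 h4]] : exists cs : seq (seq (cube d)),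
  [/\ forall C x, C \in enum CC -> x \in C -> has (fun c => x \in c) cs,
      all (fun c => size c <= K) cs,
      size cs * K <= \sum_(C <- enum CC) 3 * #|C|
    & forall S, count (predC (mono S)) cs
        <= \sum_(C <- enum CC) 2 * #|eboundary [set e in G | e \subset C] S|].
  exists cs; split => //.
  - move=> x xW; apply: (h1 (gcomp G x)); rewrite ?gcomp_refl // mem_enum.
    exact: imset_f.
  - by rewrite big_enum in h3.
  - by move=> S; have := h4 S; rewrite big_enum.
have : {subset enum CC <= CC} by move=> C; rewrite mem_enum.
elim: (enum CC) => [|C r IH] sub.
  by exists [::]; split => //; rewrite ?big_nil.
have [|cs [h1 h2 h3 h4]] := IH; first by move=> C' C'r; apply: sub; rewrite inE C'r orbT.
have /sub/imsetP[x] : C \in C :: r by rewrite inE eqxx.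
rewrite inE => Kx eC; have [|X [w [T [[cX XC xX wX sw] [TG TX hT]]]]] := @covering_walk G x #|C|.-1.
  by rewrite -eC; rewrite -eC in Kx; lia.
have CX : X = C.
  by apply/eqP; rewrite eqEcard {1}eC XC cX leqSpred.
have [cs' [fl sz ct hS]] := chop_walk w K0.
exists (cs' ++ cs); split.
- move=> C' z; rewrite inE has_cat => /orP[/eqP->|C'r] zC; last by rewrite (h1 C') ?orbT.
  apply/orP; left; have : z \in flatten cs' by rewrite fl wX CX.
  by move=> /flattenP[c c1 c2]; apply/hasP; exists c.
- by rewrite all_cat sz h2.
- rewrite size_cat big_cons; rewrite -eC in Kx; move: ct; rewrite sw; nia.
- move=> S; rewrite count_cat big_cons leq_add //.
  apply: leq_trans (hS S) _; rewrite hT leq_mul2l /=; apply: subset_leq_card.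
  apply: eboundaryS; apply/subsetP => e eT; rewrite inE (subsetP TG) //= -CX.
  exact: TX.
Qed.

End Chunks.

(** * Attaching vertices to two separated sets *)

Lemma card_bigcup_le (I T : finType) (P : {set I}) (F : I -> {set T}) :
  (#|\bigcup_(i in P) F i| <= \sum_(i in P) #|F i|)%N.
Proof.
elim/big_rec2: _ => [|i n A _ IH]; first by rewrite cards0.
by rewrite (leq_trans (leq_card_setU _ _)) // leq_add2l.
Qed.

Section Attachment.
Local Open Scope nat_scope.
Variables (d h : nat).
Implicit Types (A B W X Y S : {set cube d}) (G : {set {set cube d}}).

(** A vertex counts as attached to [A] if it lies in [A] or has [h] neighbours there. Ties go to
    [A], except for vertices of [B], so that [attached] and [attached'] are disjoint and, for
    disjoint [A] and [B], contain [A] and [B] respectively. *)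
Definition attached A B := A :|: [set x | (x \notin B) && (h <= deg A x)].
Definition attached' A B := ~: attached A B :&: (B :|: [set y | h <= deg B y]).
Definition sparse W := [set x : cube d | deg W x < 3 * h].

Lemma sum_deg_card Z X : \sum_(x in X) deg Z x <= d * #|Z|.
Proof.
rewrite sum_deg_sym mulnC -sum_nat_const; apply: leq_sum => z _; exact: deg_le.
Qed.

(** Pigeonhole: a vertex with [3 * h] neighbours in [W] has [h] of them in [A], in [B] or in the
    remainder [Z]. Double counting the edges at [Z] bounds the vertices of the last type. *)
Lemma unattached_card A B W :
  #|~: attached A B :\: attached' A B| * h
    <= #|sparse W| * h + d * #|W :\: (A :|: B)|.
Proof.
set Z := W :\: _.
apply: (@leq_trans (#|sparse W| * h + #|[set x | h <= deg Z x]| * h)).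
  rewrite -mulnDl leq_mul2r; apply/orP; right.
  apply: leq_trans (_ : #|sparse W :|: [set x | h <= deg Z x]| <= _); last first.
    by rewrite cardsU leq_subr.
  apply: subset_leq_card; apply/subsetP => x; rewrite !inE.
  case: (x \in A); case: (x \in B); case: (leqP h (deg A x)) => hA;
    case: (leqP h (deg B x)) => hB //= _.
  rewrite -implyNb -leqNgt; apply/implyP => hW.
  have : deg W x <= deg A x + deg B x + deg Z x.
    apply: leq_trans (leq_trans (degU _ _ _) (leq_add (degU A B x) (leqnn (deg Z x)))).
    by apply: degS; apply/subsetP => y yW; rewrite /Z !inE yW; case: (y \in A); case: (y \in B).
  by lia.
rewrite leq_add2l; apply: leq_trans (sum_deg_card Z [set x | h <= deg Z x]).
by rewrite -sum_nat_const; apply: leq_sum => x; rewrite inE.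
Qed.

(** Apply [cube_poincare] to [attached A B], which contains [A] and misses [B]. Its boundary edges
    end in [attached'] or in the leftover vertices, each of which receives at most [d]. *)
Lemma cut_attached A B : [disjoint A & B] ->
  #|A| * #|B| <= 2 ^ d * (\sum_(x in attached A B) deg (attached' A B) x
                        + d * #|~: attached A B :\: attached' A B|).
Proof.
move=> dis; apply: leq_trans (leq_trans (cube_poincare (attached A B)) _).
  apply: leq_mul; apply: subset_leq_card; first exact: subsetUl.
  apply/subsetP => y yB; rewrite !inE yB /= orbF.
  by rewrite (disjointFl dis yB).
rewrite leq_mul2l; apply/orP; right.
apply: leq_trans (leq_add (leqnn _) (sum_deg_card _ (attached A B))).
rewrite -big_split; apply: leq_sum => x _ /=.
apply: leq_trans (degU _ _ _); apply: degS; apply/subsetP => y yA.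
by rewrite in_setU in_setD yA andbT; case: (y \in attached' A B).
Qed.

Definition active G A X :=
  [set x in X | (x \in A) || [exists i, (flip i x \in A) && ([set x; flip i x] \in G)]].

Definition cut_edges X Y : {set {set cube d}} :=
  [set e | [exists x in X, exists i, (flip i x \in Y) && (e == [set x; flip i x])]].

Lemma cut_edgesP X Y e :
  reflect (exists x i, [/\ x \in X, flip i x \in Y & e = [set x; flip i x]]) (e \in cut_edges X Y).
Proof.
rewrite inE; apply: (iffP exists_inP) => [[x xX /existsP[i /andP[iY /eqP->]]]|[x [i [xX iY ->]]]].
  by exists x, i.
by exists x => //; apply/existsP; exists i; rewrite iY eqxx.
Qed.

Lemma card_cut_edges X Y : [disjoint X & Y] ->
  \sum_(x in X) deg Y x <= #|cut_edges X Y|.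
Proof.
move=> dis; rewrite /deg pair_big_dep /=.
apply: (@leq_trans #|[set q : cube d * 'I_d | (q.1 \in X) && (flip q.2 q.1 \in Y)]|).
  rewrite -sum1_card big_mkcond [leqRHS]big_mkcond; apply: leq_sum => -[x i] _ /=.
  by rewrite !inE /= andbT; case: (x \in X); case: (_ \in Y).
rewrite -(@card_in_imset _ _ (fun q : cube d * 'I_d => [set q.1; flip q.2 q.1])).
  apply: subset_leq_card; apply/subsetP => e /imsetP[[x i]]; rewrite inE /= => /andP[xX iY] ->.
  by apply/cut_edgesP; exists x, i.
move=> [x i] [y j]; rewrite !inE /= => /andP[xX iY] /andP[yX jY] e.
have nx : x != flip i x by rewrite eq_sym flip_neq.
case: (set2_eq nx e) => -[h1 h2].
  by subst y; rewrite (flip_inj h2).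
by rewrite -h1 (disjointFr dis xX) in jY.
Qed.

Lemma card_star (v : cube d) : #|[set e in qedges d | v \in e]| <= d.
Proof.
apply: leq_trans (_ : #|[set [set v; flip i v] | i : 'I_d]| <= _); last first.
  by apply: leq_trans (leq_imset_card _ _) _; rewrite card_ord.
apply: subset_leq_card; apply/subsetP => e; rewrite inE => /andP[/qedgesP[x [i ->]]].
rewrite !inE => /orP[/eqP->|/eqP->]; first by apply/imsetP; exists i.
by apply/imsetP; exists i => //; rewrite flipK setUC.
Qed.

(* An edge xy of cut_edges extends to a path of length at most 3 from A to B; such a
   path leaves S through an edge that shares a vertex with xy. *)
Lemma cut_edges_boundary A B X Y S (G G2 G3 G4 : {set {set cube d}}) :
  A \subset S -> [disjoint B & S] -> G \subset qedges d ->
  G2 \subset G -> G3 \subset G -> G4 \subset G ->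
  #|G4 :&: cut_edges (active G2 A X) (active G3 B Y)| <= 2 * d * #|eboundary G S|.
Proof.
move=> AS BS Gq G2G G3G G4G.
(* Every counted edge shares a vertex with a boundary edge [f], and a given [f] is met by at most
   [2 * d] edges of the cube. *)
pose near (f : {set cube d}) := [set e in qedges d | ~~ [disjoint e & f]].
have card_near f : f \in qedges d -> #|near f| <= 2 * d.
  move=> /qedgesP[x [i ->]]; rewrite mul2n -addnn.
  apply: leq_trans (leq_add (card_star x) (card_star (flip i x))).
  apply: leq_trans (leq_card_setU _ _); apply: subset_leq_card; apply/subsetP => e; rewrite !inE.
  move=> /andP[-> /=]; rewrite disjoint_sym disjoints_subset subUset !sub1set !inE.
  by case: (x \in e); case: (flip i x \in e).
apply: (@leq_trans #|\bigcup_(f in eboundary G S) near f|).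
  apply: subset_leq_card; apply/subsetP => e; rewrite inE => /andP[eG4 /cut_edgesP[x [i [xX yY ee]]]].
  have eq : e \in qedges d by apply: (subsetP Gq); apply: (subsetP G4G).
  suff [f [fb [v vf ve]]] : exists f, f \in eboundary G S /\ exists2 v, v \in f & v \in e.
    apply/bigcupP; exists f => //; rewrite inE eq /=.
    by apply/pred0Pn; exists v; apply/andP.
  have fin u v w : u \in S -> v \notin S -> [set u; v] \in G -> w \in [set u; v] -> w \in e ->
      exists f, f \in eboundary G S /\ exists2 v, v \in f & v \in e.
    move=> uS vS uvG wuv we; exists [set u; v]; split; last by exists w.
    by apply/eboundaryP => //; exists u, v.
  move: xX yY; rewrite !inE => /andP[_ xA] /andP[_ yB].
  have xe : x \in e by rewrite ee !inE eqxx.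
  have ye : flip i x \in e by rewrite ee !inE eqxx orbT.
  (* The first edge crossing the boundary is the link from [A] to [x] if [x] is outside [S], the
     edge [e] itself if only its other end is outside, and otherwise the link from that end to
     [B]. *)
  case: (boolP (x \in S)) => xS; last first.
    case/orP: xA => [/(subsetP AS)|/existsP[j /andP[jA jG]]]; first by rewrite (negbTE xS).
    apply: (fin (flip j x) x x) => //; last by rewrite !inE eqxx orbT.
      exact: (subsetP AS).
    by rewrite setUC (subsetP G2G).
  case: (boolP (flip i x \in S)) => yS; last first.
    by apply: (fin x (flip i x) x) => //; rewrite ?inE ?eqxx // -ee (subsetP G4G).
  case/orP: yB => [yB|/existsP[j /andP[jB jG]]].
    by rewrite (disjointFr BS yB) in yS.
  apply: (fin (flip i x) (flip j (flip i x)) (flip i x)) => //; rewrite ?inE ?eqxx //.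
    by rewrite (disjointFr BS jB).
  exact: (subsetP G3G).
apply: leq_trans (card_bigcup_le _ _) _; rewrite mulnC -sum_nat_const.
by apply: leq_sum => f; rewrite inE => /andP[/(subsetP Gq)/card_near].
Qed.

End Attachment.

(** * Sprinkling *)

Lemma bern_mem (R : realType) (T : finType) (p : R) (E : {set T}) e : e \in E ->
  bern p E (fun G => (e \in G)%:R) = p.
Proof.
move=> eE; rewrite (bern_step p _ eE).
rewrite (_ : bern p _ _ = 1); last first.
  by rewrite -[RHS](bern_cst p (E :\ e)); apply: eq_bern => G _; rewrite setU11.
rewrite (_ : bern p _ _ = 0); last first.
  rewrite -[RHS](bern_cst p (E :\ e)); apply: eq_bern => G.
  by rewrite subsetD1 => /andP[_ /negbTE->].
by rewrite mulr1 mulr0 addr0.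
Qed.

Lemma bern_card_ltn (R : realType) (T : finType) (p M : R) (E F : {set T}) :
  0 <= p <= 1 -> F \subset E -> M <= #|F|%:R ->
  bern p E (fun G => (#|G :&: F|%:R < p * M / 4)%R%:R) <= expR (- (p * M / 4)).
Proof.
move=> hp FE hM; have /andP[p0 p1] := hp.
rewrite (_ : bern p E _ = bern p E (fun G =>
   (\sum_(e in F) (fun=> 1) e * (e \in G)%:R < p * M / 4)%R%:R)); last first.
  apply: eq_bern => G _; congr (_ < _)%R%:R; rewrite -sum1_card natr_sum.
  rewrite big_mkcond [RHS]big_mkcond; apply: eq_bigr => e _; rewrite inE mul1r.
  by case: (e \in G); case: (e \in F).
apply: (bern_chernoff (F := fun e => [set e])) => //.
- by move=> e G _; rewrite !inE eqxx andbT.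
- by move=> e f _ _ ef; rewrite disjoints1 inE.
- by move=> e eF; rewrite bern_mem // (subsetP FE).
- by move=> e _; rewrite ler01 lexx.
- by rewrite sumr_const.
Qed.

Section Sprinkling.
Variables (R : realType) (d h : nat) (p tau : R).
Hypotheses (d0 : (0 < d)%N) (hp : 0 <= p <= 1) (tau0 : 0 <= tau) (htau : tau <= p * h%:R).
Implicit Types (A B X Y : {set cube d}).

Let q := tau / (1 + tau).

Lemma sprinkle_q : 0 <= q <= 1.
Proof.
by rewrite /q divr_ge0 ?addr_ge0 //= ler_pdivrMr ?ltr_pwDl // mul1r lerDr.
Qed.

(** Weighted [bern_chernoff] with weights [deg Y x / d], which lie in [[0, 1]]; this scaling puts
    [d] into the exponent. By [bern_meet] each [x] is active with probability at least [q]. *)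
Lemma active_lower_tail A X Y (M : R) :
  {in X, forall x, (x \in A) || (h <= deg A x)%N} ->
  M <= (\sum_(x in X) deg Y x)%:R ->
  bern p (qedges d) (fun G => ((\sum_(x in active G A X) deg Y x)%:R < q * M / 4)%R%:R)
    <= expR (- (q * M / (4 * d%:R))).
Proof.
move=> hX hM; have /andP[q0 q1] := sprinkle_q.
have dR : 0 < d%:R :> R by rewrite ltr0n.
(* Edges that can activate [x]. Vertices of [A] are active anyway and get the empty set; for [x]
   outside [A] the sets are disjoint, since an edge from [x] to [A] has only one end outside [A]. *)
pose F x : {set {set cube d}} := if x \in A then set0 else [set [set x; flip i x] | i in [set i | flip i x \in A]].
pose a x (G : {set {set cube d}}) := (x \in A) || (G :&: F x != set0).
pose w x : R := (deg Y x)%:R / d%:R.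
have -> : q * M / (4 * d%:R) = q * (M / d%:R) / 4 by field; rewrite gt_eqF.
apply: le_trans (_ : bern p (qedges d) (fun G =>
    (\sum_(x in X) w x * (a x G)%:R < q * (M / d%:R) / 4)%R%:R) <= _).
  apply: ler_bern => // G _; case: ltP => // hG.
  rewrite (_ : (_ < _)%R = true) //.
  have -> : q * (M / d%:R) / 4 = q * M / 4 / d%:R by ring.
  rewrite ltr_pdivlMr //; apply: le_lt_trans hG.
  rewrite natr_sum big_distrl /= big_mkcond [leRHS]big_mkcond; apply: ler_sum => x _.
  rewrite !inE; case: (x \in X) => //=.
  rewrite mulrAC /w divfK ?gt_eqF // /a /F; case: (x \in A) => /=; first by rewrite mulr1.
  case: existsP => [_|no]; first by rewrite ler_piMr //; case: (_ != _).
  rewrite (_ : _ :&: _ = set0) ?eqxx ?mulr0 //; apply/setP => e; rewrite !inE.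
  apply/andP => -[eG /imsetP[i]]; rewrite inE => iA ei; apply: no; exists i.
  by rewrite iA -ei.
apply: (bern_chernoff (F := F)) => //.
- by move=> x G _; rewrite /a -setIA setIid.
- move=> x y _ _ xy; rewrite /F; case: ifP => xA; first by rewrite -setI_eq0 set0I.
  case: ifP => yA; first by rewrite -setI_eq0 setI0.
  rewrite -setI_eq0; apply/eqP/setP => e; rewrite !inE; apply/negP.
  move=> /andP[/imsetP[i _ ->] /imsetP[j]]; rewrite inE => jA.
  have nx : x != flip i x by rewrite eq_sym flip_neq.
  move=> /(set2_eq nx) [[xy' _]|[xj _]]; first by rewrite xy' eqxx in xy.
  by rewrite xj jA in xA.
- move=> x xX; rewrite /a /F; case: (boolP (x \in A)) => xA /=; first by rewrite bern_cst.
  apply: bern_meet => //.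
    by apply/subsetP => e /imsetP[i _ ->]; apply: qedge_flip.
  apply: le_trans htau _; apply: ler_wpM2l; first by case/andP: hp.
  rewrite ler_nat card_in_imset; last first.
    move=> i j _ _ e; have nx : x != flip i x by rewrite eq_sym flip_neq.
    by case: (set2_eq nx e) => -[]; [move=> _ /flip_inj|by move=> xj; have := flip_neq j x; rewrite -xj eqxx].
  have := hX _ xX; rewrite (negbTE xA) /= => /leq_trans; apply.
  rewrite -sum1_card [leqRHS]big_mkcond /deg; apply: leq_sum => i _.
  by rewrite inE; case: ifP.
- move=> x _; rewrite /w divr_ge0 //= ler_pdivrMr // mul1r ler_nat.
  exact: deg_le.
- by rewrite ler_pdivrMr // big_distrl /=; apply: le_trans hM _;
    rewrite natr_sum; apply: ler_sum => x _; rewrite /w divfK // gt_eqF.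
Qed.

(* The three sprinkled sets G2, G3, G4 respectively attach X to A, attach Y to B, and
   open edges between the attached parts of X and Y. *)
Lemma sprinkle_fail A B X Y (M : R) : 0 <= M -> [disjoint X & Y] ->
  {in X, forall x, (x \in A) || (h <= deg A x)%N} ->
  {in Y, forall x, (x \in B) || (h <= deg B x)%N} ->
  M <= (\sum_(x in X) deg Y x)%:R ->
  bern p (qedges d) (fun G2 => bern p (qedges d) (fun G3 => bern p (qedges d) (fun G4 =>
    (#|G4 :&: cut_edges (active G2 A X) (active G3 B Y)|%:R
       < p * (q * (q * M / 4) / 4) / 4)%R%:R)))
  <= expR (- (q * M / (4 * d%:R))) + expR (- (q * (q * M / 4) / (4 * d%:R)))
     + expR (- (p * (q * (q * M / 4) / 4) / 4)).
Proof.
move=> M0 dis hX hY hM; set M1 := q * M / 4; set M2 := q * M1 / 4.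
have act (G : {set {set cube d}}) (A' X' : {set cube d}) : active G A' X' \subset X'.
  by apply/subsetP => x; rewrite inE => /andP[].
(* [f2] and [f3] indicate failure of the first two stages; a stage is bounded by its own tail unless
   the preceding one failed. [sum_deg_sym] lets the second stage count the same edges from the side
   of [Y]. *)
pose f2 G2 : R := ((\sum_(x in active G2 A X) deg Y x)%:R < M1)%R%:R.
pose f3 G2 G3 : R := ((\sum_(y in active G3 B Y) deg (active G2 A X) y)%:R < M2)%R%:R.
have s4 G2 G3 : bern p (qedges d) (fun G4 =>
    (#|G4 :&: cut_edges (active G2 A X) (active G3 B Y)|%:R < p * M2 / 4)%R%:R)
    <= f3 G2 G3 + expR (- (p * M2 / 4)).
  rewrite /f3; case: ltP => h3.
    apply: le_trans (_ : 1 <= _); last by rewrite lerDl expR_ge0.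
    by apply: bern_le_cst => // G _; rewrite lern1 leq_b1.
  rewrite add0r; apply: bern_card_ltn => //.
    by apply/subsetP => e /cut_edgesP[x [i [_ _ ->]]]; apply: qedge_flip.
  apply: le_trans h3 _; rewrite ler_nat -sum_deg_sym; apply: card_cut_edges.
  by apply: disjointWl (act _ _ _) (disjointWr (act _ _ _) dis).
have s3 G2 : bern p (qedges d) (f3 G2) <= f2 G2 + expR (- (q * M1 / (4 * d%:R))).
  rewrite /f2; case: ltP => h2.
    apply: le_trans (_ : 1 <= _); last by rewrite lerDl expR_ge0.
    by apply: bern_le_cst => // G _; rewrite lern1 leq_b1.
  rewrite add0r; apply: active_lower_tail => //.
  by rewrite -sum_deg_sym.
have s2 : bern p (qedges d) f2 <= expR (- (q * M / (4 * d%:R))).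
  exact: active_lower_tail.
apply: le_trans (_ : bern p (qedges d) (fun G2 =>
   f2 G2 + (expR (- (q * M1 / (4 * d%:R))) + expR (- (p * M2 / 4)))) <= _).
  apply: ler_bern => // G2 _; rewrite addrA.
  apply: le_trans (ler_bern hp (fun G3 _ => s4 G2 G3)) _.
  by rewrite bernD bern_cst lerD2r.
by rewrite bernD bern_cst -addrA lerD2r.
Qed.

End Sprinkling.

(** * The expansion property after sprinkling *)

Section Merging.
Local Open Scope nat_scope.
Variable d : nat.
Implicit Types (x : cube d) (G : {set {set cube d}}) (S : {set cube d}).

Definition medium k K G := [set x : cube d | k <= #|gcomp G x| < K].

(** A vertex that becomes big lies in a medium component of [G1] or in a component below [k]
    vertices touched by an edge of [G'], since an untouched component does not grow. Each edge
    touches at most two components. *)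
Lemma newly_big_card k K (G1 G' : {set {set cube d}}) : G' \subset qedges d -> k <= K ->
  #|bigset K (G1 :|: G') :\: bigset K G1| <= #|medium k K G1| + 2 * k * #|G'|.
Proof.
move=> G'q kK.
pose small u := if #|gcomp G1 u| < k then gcomp G1 u else set0.
pose touched (e : {set cube d}) := \bigcup_(u in e) small u.
have ct e : e \in G' -> #|touched e| <= 2 * k.
  move=> eG; apply: leq_trans (card_bigcup_le _ _) _.
  apply: (@leq_trans (\sum_(u in e) k)).
    apply: leq_sum => u _; rewrite /small; case: ifP => [/ltnW//|_].
    by rewrite cards0.
  rewrite sum_nat_const leq_mul2r; apply/orP; right.
  have /qedgesP[x [i ->]] := subsetP G'q _ eG.
  by rewrite cards2; case: (_ != _).
apply: (@leq_trans #|medium k K G1 :|: \bigcup_(e in G') touched e|); last first.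
  apply: leq_trans (leq_card_setU _ _) _; rewrite leq_add2l.
  apply: leq_trans (card_bigcup_le _ _) _; rewrite mulnC -sum_nat_const.
  exact: leq_sum.
apply: subset_leq_card; apply/subsetP => x; rewrite !inE -ltnNge => /andP[c1 c2].
rewrite c1 andbT; case: (leqP k #|gcomp G1 x|) => //= ck.
apply: contraLR c2 => no; rewrite -ltnNge; apply: leq_trans kK.
apply: leq_ltn_trans (ck); apply: subset_leq_card.
apply: gcomp_closed; first exact: gcomp_refl.
move=> u v uC; rewrite inE => /orP[|uvG]; first exact: gcomp_step.
case/negP: no; apply/bigcupP; exists [set u; v] => //.
apply/bigcupP; exists u; first by rewrite !inE eqxx.
by rewrite /small (gcomp_eq uC) ck gcomp_refl.
Qed.

(** Encoding these sets by index sets limits the candidates to [2 ^ size cs] in the union bound. *)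
Definition chunk_union (cs : seq (seq (cube d))) (I : {set 'I_(size cs)}) :=
  [set x | [exists i in I, x \in nth [::] cs i]].

(** A covered vertex missed by both [A] and [B] lies in a piece split by [S], and a piece has at
    most [K] entries. *)
Lemma chunk_union_split cs G K S : all (fun c => size c <= K) cs ->
  (forall x, x \in bigset K G -> has (fun c => x \in c) cs) ->
  let A := @chunk_union cs [set i : 'I_(size cs) | all (mem S) (nth [::] cs i)] in
  let B := @chunk_union cs [set i : 'I_(size cs) | all [predC mem S] (nth [::] cs i)] in
  [/\ A \subset S, [disjoint B & S]
    & #|bigset K G :\: (A :|: B)| <= K * count (predC (mono S)) cs].
Proof.
move=> szc cov A B; split.
- apply/subsetP => x; rewrite inE => /exists_inP[i]; rewrite inE => /allP h /h.
  by [].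
- rewrite disjoints_subset; apply/subsetP => x; rewrite !inE => /exists_inP[i].
  by rewrite inE => /allP h /h.
apply: (@leq_trans (size (flatten (filter (predC (mono S)) cs)))).
  apply: leq_trans (card_size _); apply: subset_leq_card; apply/subsetP => x.
  rewrite !inE negb_or => /andP[/andP[nA nB] Kx].
  have /hasP[c cc xc] := cov x (etrans (in_set _ _) Kx).
  apply/flattenP; exists c => //; rewrite mem_filter cc andbT /=.
  have ic : index c cs < size cs by rewrite index_mem.
  rewrite /mono negb_or; apply/andP; split.
    apply: contra nA => h; apply/exists_inP; exists (Ordinal ic); rewrite ?inE /= nth_index //.
  apply: contra nB => h; apply/exists_inP; exists (Ordinal ic); rewrite ?inE /= nth_index //.
rewrite -size_filter; elim: cs szc {cov A B} => //= c cs IH /andP[sc /IH {}IH].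
by case: (mono S c) => //=; rewrite size_cat mulnS leq_add.
Qed.

End Merging.

Section FirstRound.
Variables (R : realType) (d h k K : nat) (alpha kappa b z : R).
Implicit Types (G : {set {set cube d}}) (A B W : {set cube d}).
Let n : R := (2 ^ d)%:R.

(** The event of the theorem, with the boundary bound abstracted to [b]. *)
Definition expanding G : bool :=
  [forall L1 : {set cube d}, is_largest_comp G L1 ==>
     [forall S : {set cube d},
        [&& S \subset L1, alpha * (2 ^ d)%:R <= #|S|%:R & (#|S|.*2 <= #|L1|)%N]
          ==> (b <= #|eboundary G S|%:R)]].

(** What the pieces inside and outside a set [S] of small boundary satisfy. It refers to the first
    round only, so the pairs are fixed before sprinkling. *)
Definition separated W A B : bool :=
  [&& [disjoint A & B], alpha / 4 * n <= #|A|%:R, alpha / 4 * n <= #|B|%:R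
    & #|W :\: (A :|: B)|%:R <= kappa * n / d%:R].

Definition few_links A B (G2 G3 G4 : {set {set cube d}}) : bool :=
  #|G4 :&: cut_edges (active G2 A (attached h A B)) (active G3 B (attached' h A B))|%:R < z.

Hypotheses (d0 : (0 < d)%N) (kK : (k <= K)%N) (Kalpha : K%:R <= alpha * n).
Hypotheses (b_kappa : 2 * K%:R * b <= kappa * n / d%:R) (b_z : 2 * d%:R * b <= z).
Hypotheses (kappa0 : 0 <= kappa) (kappa_alpha : kappa <= alpha / 4).

(** A violating [S] yields a separated pair [A], [B] from its monochromatic pieces. This pair has at
    least [z] linking edges, at most [2 * d] per boundary edge of [S], contradicting [b_z]. *)
Lemma expanding_deterministic (G1 G2 G3 G4 : {set {set cube d}}) cs :
  G1 \subset qedges d -> G2 \subset qedges d -> G3 \subset qedges d -> G4 \subset qedges d ->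
  all (fun c => (size c <= K)%N) cs ->
  (forall x, x \in bigset K G1 -> has (fun c => x \in c) cs) ->
  (forall S, (count (predC (mono S)) cs <= 2 * #|eboundary G1 S|)%N) ->
  #|medium k K G1|%:R <= alpha / 8 * n ->
  (2 * k * #|G2 :|: (G3 :|: G4)|)%:R <= alpha / 8 * n ->
  (forall I J : {set 'I_(size cs)},
     separated (bigset K G1) (chunk_union I) (chunk_union J) ->
     ~~ few_links (chunk_union I) (chunk_union J) G2 G3 G4) ->
  expanding (G1 :|: (G2 :|: (G3 :|: G4))).
Proof.
move=> G1q G2q G3q G4q szc cov cnt hmed hG' hlinks.
set G := G1 :|: _; have dR : 0 < d%:R :> R by rewrite ltr0n.
have G'q : G2 :|: (G3 :|: G4) \subset qedges d by rewrite !subUset G2q G3q G4q.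
have Gq : G \subset qedges d by rewrite subUset G1q G'q.
apply/forallP => L1; apply/implyP => /andP[/existsP[x0 /eqP eL1] _].
apply/forallP => S; apply/implyP => /and3P[SL1 Sal SL].
rewrite leNgt; apply/negP => Sb.
have [AS BS hrest] := chunk_union_split S szc cov.
set A := chunk_union _ in AS hrest; set B := chunk_union _ in BS hrest.
set W := bigset K G1 in hrest *.
have rest : #|W :\: (A :|: B)|%:R <= kappa * n / d%:R.
  apply: le_trans b_kappa; apply: (@le_trans _ _ (K * (2 * #|eboundary G S|))%:R).
    rewrite ler_nat; apply: leq_trans hrest _; rewrite leq_mul2l; apply/orP; right.
    apply: leq_trans (cnt S) _; rewrite leq_mul2l; apply: subset_leq_card.
    by apply: eboundaryS; apply: subsetUl.
  rewrite !natrM mulrA (mulrC K%:R); apply: ler_wpM2l; first by rewrite mulr_ge0.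
  exact: ltW.
have n0 : 0 <= n by rewrite /n ler0n.
have rest4 : #|W :\: (A :|: B)|%:R <= alpha / 4 * n.
  apply: le_trans rest _; apply: le_trans (ler_wpM2r n0 kappa_alpha).
  by rewrite ler_pdivrMr // ler_peMr ?mulr_ge0 ?ler1n.
have L1big : L1 \subset bigset K G.
  apply/subsetP => x xL; rewrite inE -(ler_nat R).
  rewrite (gcomp_eq (_ : x \in gcomp G x0)) -?eL1 //.
  apply: le_trans Kalpha (le_trans Sal _).
  by rewrite ler_nat subset_leq_card.
have L1W : #|L1 :\: W|%:R <= alpha / 4 * n.
  apply: (@le_trans _ _ (#|medium k K G1| + 2 * k * #|G2 :|: (G3 :|: G4)|)%:R).
    rewrite ler_nat; apply: leq_trans (newly_big_card G1 G'q kK).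
    by apply: subset_leq_card; apply: setSD.
  by rewrite natrD; lra.
(* Of the [alpha n] vertices of [X], at most [alpha n / 4] lie in split pieces and at most
   [alpha n / 4] outside [W]. This serves both [S] and [L1 :\: S], which is at least as large as
   [S]. *)
have cover4 (X Y Z : {set cube d}) : X \subset L1 -> alpha * n <= #|X|%:R ->
    X \subset Y :|: (W :\: (A :|: B)) :|: (L1 :\: W) -> alpha / 4 * n <= #|Y|%:R.
  move=> XL Xal /subset_leq_card; rewrite -(ler_nat R) => h1.
  have h2 : #|Y :|: (W :\: (A :|: B)) :|: (L1 :\: W)|%:R
     <= #|Y|%:R + #|W :\: (A :|: B)|%:R + #|L1 :\: W|%:R :> R.
    rewrite -!natrD ler_nat; apply: leq_trans (leq_card_setU _ _) _.
    by rewrite leq_add2r leq_card_setU.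
  by have an : 0 <= alpha * n := le_trans (ler0n _ _) Kalpha; lra.
have dAB : [disjoint A & B].
  by apply: disjointWl AS _; rewrite disjoint_sym.
have AB x : x \in L1 -> x \in W -> x \notin A -> x \notin B -> x \in W :\: (A :|: B).
  by move=> _ xW xA xB; rewrite in_setD in_setU negb_or xA xB.
have sep : separated W A B.
  apply/and4P; split => //.
    apply: (cover4 S A set0) => //; apply/subsetP => x xS.
    rewrite 2!in_setU; case: (boolP (x \in A)) => //= xA.
    rewrite [x \in L1 :\: W]in_setD (subsetP SL1) // andbT.
    case: (boolP (x \in W)) => xW; last by rewrite orbT.
    by rewrite AB // ?(subsetP SL1) // (disjointFl BS xS).
  apply: (cover4 (L1 :\: S) B set0); first exact: subsetDl.
    apply: le_trans Sal _; rewrite ler_nat cardsDS //.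
    by rewrite leq_subRL ?subset_leq_card // addnn.
  apply/subsetP => x; rewrite inE => /andP[xS xL].
  rewrite 2!in_setU; case: (boolP (x \in B)) => //= xB.
  rewrite [x \in L1 :\: W]in_setD xL andbT.
  case: (boolP (x \in W)) => xW; last by rewrite orbT.
  by rewrite AB //; apply: contra xS; apply: (subsetP AS).
have := hlinks _ _ sep; rewrite /few_links -leNgt => hz.
have GG (H : {set {set cube d}}) : H \subset G2 :|: (G3 :|: G4) -> H \subset G.
  by move=> h1; apply: subset_trans h1 (subsetUr _ _).
have := @cut_edges_boundary d A B (attached h A B) (attached' h A B) S G G2 G3 G4 AS BS Gq.
move=> /(_ (GG _ (subsetUl _ _))) /(_ (GG _ _)).
move=> /(_ (subset_trans (subsetUl _ _) (subsetUr _ _))) /(_ (GG _ _)).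
move=> /(_ (subset_trans (subsetUr _ _) (subsetUr _ _))).
rewrite -(ler_nat R) => /(le_trans hz); rewrite natrM => hz2.
have : 2 * d%:R * #|eboundary G S|%:R < 2 * d%:R * b by rewrite ltr_pM2l // mulr_gt0.
by move=> h1; have := lt_le_trans h1 b_z; rewrite natrM in hz2; rewrite ltNge hz2.
Qed.

End FirstRound.

(** * Union bound over separated pairs *)

Section ThreeRounds.
Variables (R : realType) (T : finType) (p : R) (E : {set T}).
Hypothesis hp : 0 <= p <= 1.

Definition bern3 (f : {set T} -> {set T} -> {set T} -> R) : R :=
  bern p E (fun G2 => bern p E (fun G3 => bern p E (fun G4 => f G2 G3 G4))).

Lemma ler_bern3 (f g : {set T} -> {set T} -> {set T} -> R) :
  (forall G2 G3 G4 : {set T}, G2 \subset E -> G3 \subset E -> G4 \subset E -> f G2 G3 G4 <= g G2 G3 G4) ->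
  bern3 f <= bern3 g.
Proof.
by move=> fg; do 3![apply: ler_bern => // ? ?]; apply: fg.
Qed.

Lemma bern3D f g :
  bern3 (fun G2 G3 G4 => f G2 G3 G4 + g G2 G3 G4) = bern3 f + bern3 g.
Proof.
rewrite /bern3 -bernD; apply: eq_bern => G2 _; rewrite -bernD.
by apply: eq_bern => G3 _; rewrite -bernD.
Qed.

Lemma bern3Z c f : bern3 (fun G2 G3 G4 => c * f G2 G3 G4) = c * bern3 f.
Proof.
rewrite /bern3 -bernZ; apply: eq_bern => G2 _; rewrite -bernZ.
by apply: eq_bern => G3 _; rewrite -bernZ.
Qed.

Lemma bern3_sum (I : finType) (P : pred I) (f : I -> {set T} -> {set T} -> {set T} -> R) :
  bern3 (fun G2 G3 G4 => \sum_(i | P i) f i G2 G3 G4) = \sum_(i | P i) bern3 (f i).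
Proof.
rewrite /bern3 -bern_sum; apply: eq_bern => G2 _; rewrite -bern_sum.
by apply: eq_bern => G3 _; rewrite -bern_sum.
Qed.

Lemma bern3_card_union :
  bern3 (fun G2 G3 G4 => #|G2 :|: (G3 :|: G4)|%:R) <= 3 * (p * #|E|%:R).
Proof.
apply: le_trans (_ : bern3 (fun G2 G3 G4 => #|G2|%:R + (#|G3|%:R + #|G4|%:R)) <= _).
  apply: ler_bern3 => G2 G3 G4 _ _ _; rewrite -!natrD ler_nat.
  apply: leq_trans (leq_card_setU _ _) _; rewrite leq_add2l; exact: leq_card_setU.
rewrite 2!bern3D /bern3.
under [in X in _ + (X + _)]eq_bern => G2 _ do under eq_bern => G3 _ do rewrite bern_cst.
under [in X in X + _]eq_bern => G2 _ do rewrite !bern_cst.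
under [in X in _ + (X + _)]eq_bern => G2 _ do rewrite bern_card.
under [in X in _ + (_ + X)]eq_bern => G2 _ do under eq_bern => G3 _ do rewrite bern_card.
under [in X in _ + (_ + X)]eq_bern => G2 _ do rewrite bern_cst.
by rewrite bern_card !bern_cst; move: (p * _) => a; lra.
Qed.

End ThreeRounds.

Lemma bern_union3 (R : realType) (T : finType) (p p1 p2 : R) (E : {set T}) f :
  1 - p = (1 - p1) * (1 - p2) ^+ 3 ->
  bern p E f = bern p1 E (fun G1 =>
    bern3 p2 E (fun G2 G3 G4 => f (G1 :|: (G2 :|: (G3 :|: G4))))).
Proof.
move=> hp; rewrite (@bern_union _ _ p p1 (1 - (1 - p2) ^+ 3)); last by rewrite hp; ring.
apply: eq_bern => G1 _.
rewrite (@bern_union _ _ _ p2 (1 - (1 - p2) ^+ 2)); last by ring.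
apply: eq_bern => G2 _.
by rewrite (@bern_union _ _ _ p2 p2); last by ring.
Qed.

Lemma card_qedges d : (#|qedges d| <= 2 ^ d * d)%N.
Proof.
rewrite -card_cube -[X in (_ * X)%N]card_ord -[X in (_ * X)%N]cardsT -cardsX.
apply: leq_trans (leq_imset_card (fun q : cube d * 'I_d => [set q.1; flip q.2 q.1]) _).
apply: subset_leq_card; apply/subsetP => e /qedgesP[x [i ->]].
by apply/imsetP; exists (x, i) => //; rewrite !inE.
Qed.

Section SecondRound.
Variables (R : realType) (d h k K : nat) (alpha kappa b p tau M : R).
Let n : R := (2 ^ d)%:R.
Let q := tau / (1 + tau).
Let z := p * (q * (q * M / 4) / 4) / 4.
Let err := expR (- (q * M / (4 * d%:R))) + expR (- (q * (q * M / 4) / (4 * d%:R)))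
     + expR (- (p * (q * (q * M / 4) / 4) / 4)).
Hypotheses (d0 : (0 < d)%N) (h0 : (0 < h)%N) (K0 : (0 < K)%N) (kK : (k <= K)%N).
Hypotheses (alpha0 : 0 < alpha) (Kalpha : K%:R <= alpha * n).
Hypotheses (hp : 0 <= p <= 1) (tau0 : 0 <= tau) (htau : tau <= p * h%:R).
Hypotheses (b_kappa : 2 * K%:R * b <= kappa * n / d%:R) (b_z : 2 * d%:R * b <= z).
Hypotheses (kappa0 : 0 <= kappa) (kappa_alpha : kappa <= alpha / 4).
Hypotheses (M0 : 0 <= M) (hM : M <= ((alpha / 4) ^+ 2 - kappa * (1 + d%:R / h%:R)) * n).

(** [cut_attached] gives a cut of order [(alpha / 4) ^+ 2 * n] after division by [n]; by
    [unattached_card] the leftover vertices take away at most [kappa n (1 + d / h)]. *)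
Lemma separated_cut (W A B : {set cube d}) : separated alpha kappa W A B ->
  #|sparse h W|%:R <= kappa * n / d%:R ->
  M <= (\sum_(x in attached h A B) deg (attached' h A B) x)%:R.
Proof.
move=> /and4P[dis Aal Bal rest] sp.
have dR : 0 < d%:R :> R by rewrite ltr0n.
have hR : 0 < h%:R :> R by rewrite ltr0n.
have nR : 0 < n by rewrite /n ltr0n expn_gt0.
have := unattached_card h A B W; have := cut_attached h dis.
move: (\sum_(x in _) _)%N => sm; move: #|_ :\: attached' _ _ _| => ex.
rewrite -(ler_nat R) => h1; rewrite -(ler_nat R) => h2.
have {h2} h2 : d%:R * ex%:R <= kappa * n * (1 + d%:R / h%:R).
  rewrite -(ler_pM2r hR); apply: (@le_trans _ _ (d%:R * (kappa * n / d%:R * h%:R + d%:R * (kappa * n / d%:R)))).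
    rewrite -[leLHS]mulrA ler_pM2l // -natrM; apply: le_trans h2 _; rewrite natrD !natrM.
    by apply: lerD; [apply: ler_wpM2r|apply: ler_wpM2l].
  rewrite le_eqVlt; apply/orP; left; apply/eqP; field.
  by rewrite !gt_eqF.
have {}h1 : (alpha / 4) ^+ 2 * n <= sm%:R + d%:R * ex%:R.
  rewrite -(ler_pM2l nR); apply: le_trans (_ : #|A|%:R * #|B|%:R <= _); last first.
    by move: h1; rewrite !natrM natrD natrM.
  have -> : n * ((alpha / 4) ^+ 2 * n) = (alpha / 4 * n) * (alpha / 4 * n) by ring.
  by apply: ler_pM => //; rewrite mulr_ge0 ?ltW // divr_gt0.
by move: hM; rewrite mulrBl; move: h1 h2; rewrite mulrAC; lra.
Qed.

(** Failure means too many sprinkled edges, handled by Markov's inequality through [many], or too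
    few links for some separated pair, handled by a union bound over pairs of index sets. *)
Lemma expanding_second_round (G1 : {set {set cube d}}) : G1 \subset qedges d ->
  #|medium k K G1|%:R <= alpha / 8 * n ->
  #|sparse h (bigset K G1)|%:R <= kappa * n / d%:R ->
  bern3 p (qedges d) (fun G2 G3 G4 => (~~ expanding alpha b (G1 :|: (G2 :|: (G3 :|: G4))))%:R)
   <= 48 * k%:R * p * d%:R / alpha + expR (6 * n / K%:R) * err.
Proof.
move=> G1q med sp.
have nR : 0 < n by rewrite /n ltr0n expn_gt0.
have [cs [cov szc ncs cnt]] := bigset_chunks G1 K0.
pose N := size cs.
pose sepIJ (IJ : {set 'I_N} * {set 'I_N}) :=
  separated alpha kappa (bigset K G1) (chunk_union IJ.1) (chunk_union IJ.2).
pose fl (IJ : {set 'I_N} * {set 'I_N}) (G2 G3 G4 : {set {set cube d}}) : R :=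
  (few_links h z (chunk_union IJ.1) (chunk_union IJ.2) G2 G3 G4)%:R.
pose many (G2 G3 G4 : {set {set cube d}}) : R :=
  2 * k%:R * 8 / (alpha * n) * #|G2 :|: (G3 :|: G4)|%:R.
have an : 0 < alpha * n by rewrite mulr_gt0.
apply: le_trans (_ : bern3 p (qedges d) (fun G2 G3 G4 =>
    many G2 G3 G4 + \sum_(IJ | sepIJ IJ) fl IJ G2 G3 G4) <= _).
  apply: ler_bern3 => // G2 G3 G4 G2q G3q G4q.
  have many0 : 0 <= many G2 G3 G4.
    by rewrite /many mulr_ge0 // divr_ge0 ?(ltW an) // ?mulr_ge0.
  have sum0 : 0 <= \sum_(IJ | sepIJ IJ) fl IJ G2 G3 G4 by apply: sumr_ge0.
  case: (boolP (expanding _ _ _)) => hE /=; first by rewrite addr_ge0.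
  case: (lerP (2 * k * #|G2 :|: (G3 :|: G4)|)%:R (alpha / 8 * n)) => hG'; last first.
    rewrite -[leLHS]addr0; apply: lerD => //.
    move: hG'; rewrite /many !natrM.
    have -> : 2 * k%:R * 8 / (alpha * n) * #|G2 :|: (G3 :|: G4)|%:R
       = 2 * k%:R * #|G2 :|: (G3 :|: G4)|%:R * 8 / (alpha * n) by ring.
    rewrite ler_pdivlMr // mul1r; lra.
  case: (pickP (fun IJ => sepIJ IJ && few_links h z (chunk_union IJ.1) (chunk_union IJ.2) G2 G3 G4)) => [IJ /andP[s f]|no].
    rewrite -[leLHS]add0r; apply: lerD => //; rewrite (bigD1 IJ) //= /fl f lerDl.
    exact: sumr_ge0.
  case/negP: hE; apply: (@expanding_deterministic R d h k K alpha kappa b z d0 kK Kalpha b_kappa b_z kappa0 kappa_alpha G1 G2 G3 G4 cs) => //.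
  by move=> I J sIJ; have := no (I, J); rewrite /sepIJ /= sIJ /= => ->.
rewrite bern3D; apply: lerD.
  rewrite bern3Z; apply: le_trans (ler_wpM2l _ (bern3_card_union _ hp)) _.
    by rewrite divr_ge0 ?(ltW an) // ?mulr_ge0.
  have hE : #|qedges d|%:R <= n * d%:R by rewrite -natrM ler_nat card_qedges.
  apply: (@le_trans _ _ (2 * k%:R * 8 / (alpha * n) * (3 * (p * (n * d%:R))))).
    apply: ler_wpM2l; first by rewrite divr_ge0 ?(ltW an) // ?mulr_ge0.
    apply: ler_wpM2l => //; apply: ler_wpM2l => //; by case/andP: hp.
  rewrite le_eqVlt; apply/orP; left; apply/eqP; field.
  by rewrite !gt_eqF.
rewrite bern3_sum; apply: (@le_trans _ _ (\sum_(IJ | sepIJ IJ) err)).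
  apply: ler_sum => -[I J] sIJ; apply: (sprinkle_fail (h := h)) => //.
  - rewrite disjoint_sym disjoints_subset; apply/subsetP => y.
    by rewrite in_setI => /andP[].
  - move=> x; rewrite in_setU => /orP[->//|]; rewrite inE => /andP[_ ->].
    by rewrite orbT.
  - move=> x; rewrite in_setI in_setU => /andP[_ /orP[->//|]]; rewrite inE => ->.
    by rewrite orbT.
  - exact: separated_cut sIJ sp.
have err0 : 0 <= err by rewrite /err !addr_ge0 ?expR_ge0.
apply: (@le_trans _ _ (\sum_(IJ : {set 'I_N} * {set 'I_N}) err)).
  by rewrite [leRHS](bigID sepIJ) /= lerDl sumr_ge0.
have cset : #|{set 'I_N}| = (2 ^ N)%N.
  by rewrite -cardsT -powersetT card_powerset cardsT card_ord.
rewrite sumr_const card_prod cset -[_ *+ _]mulr_natl; apply: ler_wpM2r => //.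
have KR : 0 < K%:R :> R by rewrite ltr0n.
(* There are [4 ^ N <= exp (2 N)] pairs, and [N K <= 3 n]. *)
apply: (@le_trans _ _ (expR (2 * N%:R))).
  rewrite -expnD natrX addnn -muln2 -natrM mulnC -[X in expR X]mulr1 expRM_natl.
  apply: lerXn2r; rewrite ?nnegrE ?expR_ge0 //.
  exact: expR_ge1Dx.
rewrite ler_expR ler_pdivlMr //.
have : (N * K)%:R <= (3 * 2 ^ d)%:R :> R by rewrite ler_nat.
rewrite !natrM -/n; lra.
Qed.

End SecondRound.

(** * The first round *)

Lemma bern_card_set (R : realType) (T V : finType) (p c : R) (E : {set T})
    (A : {set T} -> {set V}) : 0 <= p <= 1 ->
  (forall x, bern p E (fun G => (x \in A G)%:R) <= c) ->
  bern p E (fun G => #|A G|%:R) <= #|V|%:R * c.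
Proof.
move=> hp hc; rewrite mulr_natl -sumr_const.
have -> : bern p E (fun G => #|A G|%:R) = \sum_(x : V) bern p E (fun G => (x \in A G)%:R).
  rewrite -bern_sum; apply: eq_bern => G _; rewrite -sum1_card natr_sum big_mkcond.
  by apply: eq_bigr => x _; case: (x \in A G).
exact: ler_sum.
Qed.

Section FiniteDimension.
Variables (R : realType) (d m h k K t : nat).
Variables (alpha kappa b p p1 p2 tau M s theta : R).
Let n : R := (2 ^ d)%:R.
Let q := tau / (1 + tau).
Let z := p2 * (q * (q * M / 4) / 4) / 4.
Let err := expR (- (q * M / (4 * d%:R))) + expR (- (q * (q * M / 4) / (4 * d%:R)))
     + expR (- (p2 * (q * (q * M / 4) / 4) / 4)).
Hypotheses (d0 : (0 < d)%N) (h0 : (0 < h)%N) (K0 : (0 < K)%N) (kK : (k <= K)%N).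
Hypotheses (alpha0 : 0 < alpha) (Kalpha : K%:R <= alpha * n).
Hypotheses (hp2 : 0 <= p2 <= 1) (tau0 : 0 <= tau) (htau : tau <= p2 * h%:R).
Hypotheses (b_kappa : 2 * K%:R * b <= kappa * n / d%:R) (b_z : 2 * d%:R * b <= z).
Hypotheses (kappa0 : 0 < kappa) (kappa_alpha : kappa <= alpha / 4).
Hypotheses (M0 : 0 <= M) (hM : M <= ((alpha / 4) ^+ 2 - kappa * (1 + d%:R / h%:R)) * n).
Hypotheses (p10 : 0 <= p1) (p11 : p1 < 1) (hp : 1 - p = (1 - p1) * (1 - p2) ^+ 3).
Hypotheses (s0 : 0 <= s) (s1 : s < 1) (theta1 : 1 <= theta) (Kt : (K <= 2 ^ t)%N).
Hypothesis hth : theta <= (1 - s) * (1 + s * (p1 * (d - m - 2 * t)%:R)).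
Hypotheses (md : (m <= d)%N) (hm : (3 * h)%:R <= s * m%:R / 4).

(** Markov's inequality bounds the chance of many medium vertices and of many sparse ones; otherwise
    the second round applies. *)
Lemma not_expanding_prob :
  bern p (qedges d) (fun G => (~~ expanding alpha b G)%:R)
   <= 8 / alpha * theta ^- k + d%:R / kappa * expR (- (s * m%:R / 4))
      + (48 * k%:R * p2 * d%:R / alpha + expR (6 * n / K%:R) * err).
Proof.
have hp1 : 0 <= p1 <= 1 by rewrite p10 ltW.
have nR : 0 < n by rewrite /n ltr0n expn_gt0.
have dR : 0 < d%:R :> R by rewrite ltr0n.
have cV : #|{: cube d}|%:R = n by rewrite -cardsT card_cube.
have err0 : 0 <= err by rewrite /err !addr_ge0 ?expR_ge0.
set c := (X in _ + X); have c0 : 0 <= c.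
  have /andP[p20 _] := hp2.
  by rewrite /c addr_ge0 // ?divr_ge0 ?mulr_ge0 ?expR_ge0 // ltW.
pose f1 (G : {set {set cube d}}) : R := 8 / (alpha * n) * #|medium k K G|%:R.
pose f2 (G : {set {set cube d}}) : R := d%:R / (kappa * n) * #|sparse h (bigset K G)|%:R.
have a1 : 0 <= 8 / (alpha * n) by rewrite divr_ge0 // mulr_ge0 // ltW.
have a2 : 0 <= d%:R / (kappa * n) by rewrite divr_ge0 // mulr_ge0 // ltW.
rewrite (bern_union3 _ _ hp).
apply: le_trans (_ : bern p1 (qedges d) (fun G => f1 G + f2 G + c) <= _).
  apply: ler_bern => // G1 G1q.
  have f10 : 0 <= f1 G1 by rewrite mulr_ge0.
  have f20 : 0 <= f2 G1 by rewrite mulr_ge0.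
  have le1 : bern3 p2 (qedges d) (fun G2 G3 G4 =>
      (~~ expanding alpha b (G1 :|: (G2 :|: (G3 :|: G4))))%:R) <= 1 :> R.
    by do 3![apply: bern_le_cst => // ? _]; rewrite lern1 leq_b1.
  case: (lerP #|medium k K G1|%:R (alpha / 8 * n)) => hmed; last first.
    apply: le_trans le1 _; rewrite -addrA ler_wpDr ?(addr_ge0 f20 c0) //.
    rewrite /f1 mulrAC ler_pdivlMr ?mulr_gt0 // mul1r.
    by apply: ltW; move: hmed; lra.
  case: (lerP #|sparse h (bigset K G1)|%:R (kappa * n / d%:R)) => hsp; last first.
    apply: le_trans le1 _; rewrite addrAC -[leLHS]add0r lerD ?(addr_ge0 f10 c0) //.
    rewrite /f2 mulrAC ler_pdivlMr ?mulr_gt0 // mul1r.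
    by apply: ltW; move: hsp; rewrite ltr_pdivrMr // [X in _ < X]mulrC.
  rewrite -[leLHS]add0r lerD ?(addr_ge0 f10 f20) //.
  by apply: (expanding_second_round d0 h0 K0 kK alpha0 Kalpha hp2 tau0 htau
     b_kappa b_z (ltW kappa0) kappa_alpha M0 hM).
rewrite 2!bernD bern_cst lerD2r lerD //.
  rewrite bernZ; apply: le_trans (ler_wpM2l a1 (bern_card_set (c := theta ^- k) hp1 _)) _.
    move=> x; under eq_bern => G _ do rewrite inE.
    apply: (@medium_component _ _ _ s _ _ t) => //.
    apply: le_trans hth _; apply: ler_wpM2l; first by rewrite subr_ge0 ltW.
    rewrite lerD2l; apply: ler_wpM2l => //; apply: ler_wpM2l => //.
    by rewrite ler_nat leq_sub2r // leq_subr.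
  rewrite cV le_eqVlt; apply/orP; left; apply/eqP; move: (theta ^- k) => u; field.
  by rewrite !gt_eqF.
rewrite bernZ; apply: le_trans (ler_wpM2l a2 (bern_card_set (c := expR (- (s * m%:R / 4))) hp1 _)) _.
  (* The first [m] directions index the tested neighbours and the other [d - m] span their subcubes.
     By [hm] a sparse vertex falls below the threshold of [few_big_neighbours]. *)
  move=> x; pose D := [set i : 'I_d | (i < m)%N].
  have cD : #|D| = m.
    rewrite /D -sum1_card big_mkcond /= (eq_bigr (fun i : 'I_d => (i < m)%N : nat)); last first.
      by move=> i _; rewrite inE; case: (_ < _)%N.
    rewrite -big_mkcond /= -(big_ord_widen d (fun=> 1%N) md) sum1_card card_ord; done.
  rewrite -cD; apply: le_trans (few_big_neighbours (t := t) (theta := theta) (K := K) (D := D) p10 p11 s0 s1 theta1 Kt x _) => //.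
    apply: ler_bern => // G _; rewrite inE cD.
    case: ltnP => // hx; rewrite (_ : (_ < _)%R = true) //.
    by apply: lt_le_trans hm; rewrite ltr_nat.
  by rewrite cD.
rewrite cV le_eqVlt; apply/orP; left; apply/eqP; move: (expR _) => u; field.
by rewrite !gt_eqF.
Qed.

End FiniteDimension.

(** * Choice of the constants *)

Section Asymptotics.
Variable R : realType.

Lemma nat_between (y : R) : 2 <= y -> exists m : nat, y / 2 <= m%:R <= y.
Proof.
move=> y2; exists (Num.truncn y); have y0 : 0 <= y by lra.
have /andP[h1 h2] := truncn_itv y0; rewrite h1 andbT.
by move: h2; rewrite -natr1; lra.
Qed.

Lemma nat_above (y : R) : exists D : nat, forall d : nat, (D <= d)%N -> y <= d%:R.
Proof.
exists (Num.truncn `|y|).+1 => d hd; apply: le_trans (ler_norm y) _.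
have /andP[_ h] := truncn_itv (normr_ge0 y).
by apply: le_trans (ltW h) _; rewrite ler_nat.
Qed.

Lemma nat_above_all (r : seq R) :
  exists D : nat, forall d : nat, (D <= d)%N -> all (fun y => y <= d%:R) r.
Proof.
elim: r => [|y r [D2 hD2]]; first by exists 0%N.
have [D1 hD1] := nat_above y; exists (maxn D1 D2) => d; rewrite geq_max /=.
by move=> /andP[/hD1-> /hD2->].
Qed.

Lemma sqr_le_exp2 m : (m ^ 2 <= 2 * 2 ^ m)%N.
Proof.
elim: m => // m IH; case: (leqP m 2) => [|m2]; first by case: m IH => [|[|[|]]].
by rewrite [(2 ^ m.+1)%N]expnS; move: IH; rewrite !expnS !expn0 !muln1; nia.
Qed.

Lemma sqr_le_exp2R m : m%:R ^+ 2 / 2 <= (2 ^ m)%:R :> R.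
Proof.
have := sqr_le_exp2 m; rewrite -(ler_nat R) natrM natrX; lra.
Qed.

Lemma sqr_le_expR (y : R) : 0 <= y -> (y / 2) ^+ 2 <= expR y.
Proof.
move=> y0; rewrite -[in leRHS](divfK (_ : 2 != 0) y) ?pnatr_eq0 // expRM_natr.
apply: lerXn2r; rewrite ?nnegrE ?expR_ge0 ?divr_ge0 //.
by apply: le_trans (expR_ge1Dx _); lra.
Qed.

(** Solve the relation for [p1]. As [(1 - p2) ^+ 3 >= 1 - 3 p2], this gives [p1 >= p - 3 p2], and
    [delta <= e0 / 12] costs at most a quarter of [e0]. *)
Lemma split_density (eps e0 delta : R) (d : nat) :
  0 < e0 <= eps -> e0 <= 1 -> 0 < delta <= e0 / 12 -> 1 + eps < d%:R ->
  exists p1 : R, [/\ 0 <= p1, p1 < 1,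
    1 - (1 + eps) / d%:R = (1 - p1) * (1 - delta / d%:R) ^+ 3
    & (1 + 3 / 4 * e0) / d%:R <= p1].
Proof.
move=> /andP[e00 e0eps] e01 /andP[delta0 deltae] hd.
have dR : 0 < d%:R :> R by lra.
set p := (1 + eps) / d%:R; set p2 := delta / d%:R.
have p1 : p < 1 by rewrite /p ltr_pdivrMr // mul1r.
have p20 : 0 < p2 by rewrite divr_gt0.
have pp2 : (1 + 3 / 4 * e0) / d%:R <= p - 3 * p2.
  rewrite /p /p2 mulrA -mulrBl ler_pM2r ?invr_gt0 //; lra.
have e0d : 0 < (1 + 3 / 4 * e0) / d%:R by rewrite divr_gt0 //; lra.
have p2s : p2 < 1 / 3 by lra.
have c0 : 0 < (1 - p2) ^+ 3 by rewrite exprn_gt0 //; lra.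
have cube3 : 1 - 3 * p2 <= (1 - p2) ^+ 3.
  have -> : (1 - p2) ^+ 3 = 1 - 3 * p2 + p2 ^+ 2 * (3 - p2) by ring.
  by rewrite lerDl mulr_ge0 ?sqr_ge0 //; lra.
have le : p - 3 * p2 <= 1 - (1 - p) / (1 - p2) ^+ 3.
  rewrite lerBrDr -lerBrDl ler_pdivrMr //.
  apply: (@le_trans _ _ ((1 - (p - 3 * p2)) * (1 - 3 * p2))); first by nra.
  by apply: ler_wpM2l => //; lra.
exists (1 - (1 - p) / (1 - p2) ^+ 3); split.
- by lra.
- by rewrite ltrBlDr ltrDl divr_gt0 //; lra.
- by rewrite subKr divfK ?gt_eqF.
- by lra.
Qed.

(** Losing [3 m <= e0 d / 8] directions leaves mean degree at least [1 + e1]. The choice of [s]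
    makes [s (1 + e1) = e1 / 2], for which [(1 - s) (1 + e1 / 2)] is exactly [1 + s e1 / 2]. *)
Lemma theta_bound (e0 p1 : R) (d m : nat) : let e1 := e0 / 4 in
  let s := e1 / (2 * (1 + e1)) in
  0 < e0 <= 1 -> (0 < d)%N -> m%:R <= e0 / 24 * d%:R -> (1 + 3 / 4 * e0) / d%:R <= p1 ->
  [/\ 0 < s, s < 1 & 1 + s * e1 / 2 <= (1 - s) * (1 + s * (p1 * (d - m - 2 * m)%:R))].
Proof.
move=> e1 s /andP[e00 e01] d0 hm hp1.
have dR : 0 < d%:R :> R by rewrite ltr0n.
have e10 : 0 < e1 by rewrite /e1; lra.
have s0 : 0 < s by rewrite /s divr_gt0 // mulr_gt0 //; lra.
have es : s * (1 + e1) = e1 / 2 by rewrite /s; field; lra.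
have s1 : s < 1 by nra.
split=> //.
have hD : d%:R * (1 - e0 / 8) <= (d - m - 2 * m)%:R.
  rewrite -subnDA natrB; first by rewrite natrD natrM; lra.
  by rewrite -(ler_nat R) natrD natrM; nra.
have hpD : 1 + e1 <= p1 * (d - m - 2 * m)%:R.
  apply: (@le_trans _ _ ((1 + 3 / 4 * e0) / d%:R * (d%:R * (1 - e0 / 8)))); last first.
    apply: ler_pM => //; first by rewrite divr_ge0 //; lra.
    by rewrite mulr_ge0 //; lra.
  rewrite mulrA divfK ?gt_eqF // /e1; nra.
apply: (@le_trans _ _ ((1 - s) * (1 + s * (1 + e1)))).
  by rewrite es; lra.
apply: ler_wpM2l; first by lra.
by rewrite lerD2l; apply: ler_wpM2l => //; apply: ltW.
Qed.

(** Here [K = C d]: by [12 <= c * C] the entropy [6 n / K] is at most half of [c n / d], and the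
    remaining half exceeds any constant because [n / d >= d / 2]. *)
Lemma exp_decay_union (c n C d eta : R) : 0 < c -> 0 < d -> 0 < n -> 0 < eta ->
  12 <= c * C -> d ^+ 2 / 2 <= n -> 60 <= c * eta * d ->
  expR (6 * n / (C * d)) * (3 * expR (- (c * n / d))) <= eta / 5.
Proof.
move=> c0 d0 n0 eta0 cC dn hd.
have C0 : 0 < C by have := lt_le_trans (ltr0n R 12) cC; rewrite pmulr_rgt0.
have w0 : 0 < n / d by rewrite divr_gt0.
have hw : d / 2 <= n / d by rewrite ler_pdivlMr // mulrAC.
have -> : 6 * n / (C * d) = 6 / C * (n / d) by field; rewrite !gt_eqF.
have -> : c * n / d = c * (n / d) by rewrite mulrA.
move: (n / d) w0 hw => w w0 hw; rewrite mulrCA -expRD.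
have h1 : 6 / C <= c / 2 by rewrite ler_pdivrMr //; lra.
have y0 : 0 < c / 2 * w by rewrite mulr_gt0 ?divr_gt0.
apply: (@le_trans _ _ (3 * expR (- (c / 2 * w)))).
  by rewrite ler_wpM2l // ler_expR; nra.
have h2 : expR (- (c / 2 * w)) <= (c / 2 * w)^-1.
  rewrite expRN lef_pV2 ?posrE ?expR_gt0 //.
  by apply: le_trans (expR_ge1Dx _); rewrite lerDr.
apply: (@le_trans _ _ (3 * (c / 2 * w)^-1)); first by rewrite ler_wpM2l.
rewrite ler_pdivrMr //.
have h3 : c * eta * (d / 2) <= c * eta * w by rewrite ler_wpM2l // ltW // mulr_gt0.
lra.
Qed.

(** The constants are chosen in the order [k], [delta], [kappa], [c], [C], all before [d]. Each of
    the four error terms is at most [eta / 5]. *)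
Lemma not_expanding_whp (eps alpha eta : R) :
  0 < eps -> 0 < alpha -> alpha <= 1 -> 0 < eta ->
  exists D : nat, forall (d : nat) (b : R), (D <= d)%N ->
    b <= (2 ^ d)%:R / d%:R ^+ 3 ->
    bern ((1 + eps) / d%:R) (qedges d) (fun G => (~~ expanding alpha b G)%:R) <= eta.
Proof.
move=> eps0 alpha0 alpha1 eta0.
pose e0 := Num.min eps 1.
have e00 : 0 < e0 by rewrite lt_min eps0 ltr01.
have e0eps : e0 <= eps by rewrite ge_min lexx.
have e01 : e0 <= 1 by rewrite ge_min lexx orbT.
pose e1 := e0 / 4; pose s := e1 / (2 * (1 + e1)).
have e10 : 0 < e1 by rewrite divr_gt0.
have s0 : 0 < s by rewrite divr_gt0 // mulr_gt0 // addr_gt0.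
pose theta := 1 + s * e1 / 2.
have se0 : 0 < s * e1 / 2 by rewrite divr_gt0 // mulr_gt0.
have theta1 : 1 <= theta by rewrite lerDl ltW.
have [k hk] : exists k : nat, 8 / alpha * theta ^- k <= eta / 5.
  have [k hk] := nat_above (40 / (alpha * eta) / (s * e1 / 2)).
  exists k; have {hk} := hk k (leqnn k); rewrite ler_pdivrMr // ler_pdivrMr ?mulr_gt0 // => hk.
  have bern_k j : 1 + j%:R * (s * e1 / 2) <= theta ^+ j.
    elim: j => [|j IH]; first by rewrite mul0r addr0.
    rewrite exprS; apply: le_trans (ler_wpM2l (le_trans ler01 theta1) IH).
    rewrite /theta -natr1; have := mulr_ge0 (ler0n R j) (mulr_ge0 (ltW se0) (ltW se0)).
    by move: (s * e1 / 2) => u; nra.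
  have th0 : 0 < theta ^+ k by rewrite exprn_gt0 // (lt_le_trans ltr01 theta1).
  rewrite ler_pdivrMr // ler_pdivrMr //.
  have hk2 : alpha * eta * (k%:R * (s * e1 / 2)) <= alpha * eta * theta ^+ k.
    rewrite ler_pM2l ?mulr_gt0 //; apply: le_trans (bern_k k).
    by rewrite lerDr.
  by move: hk hk2; move: (theta ^+ k) (k%:R * (s * e1 / 2)) => u v; lra.
(* The second entry keeps the expected effect of sprinkling on small components below [eta / 5];
   [k.+1] keeps the denominator positive. *)
pose delta := Num.min (e0 / 12) (alpha * eta / (240 * k.+1%:R)).
have delta0 : 0 < delta by rewrite lt_min !divr_gt0 ?mulr_gt0.
have delta_e : delta <= e0 / 12 by rewrite ge_min lexx.
have delta_k : 48 * k%:R * delta / alpha <= eta / 5.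
  have : delta <= alpha * eta / (240 * k.+1%:R) by rewrite ge_min lexx orbT.
  rewrite ler_pdivlMr ?mulr_gt0 // ler_pdivrMr // -natr1.
  by have := mulr_ge0 (ltW delta0) (ler0n R k); lra.
pose cm := e0 / 48; have cm0 : 0 < cm by rewrite divr_gt0.
pose ch := s * cm / 24; have ch0 : 0 < ch by rewrite divr_gt0 // mulr_gt0.
(* As [d / h <= ch^-1], the leftover term is at most [alpha ^+ 2 / 32], half of [(alpha / 4) ^+ 2];
   the other half is [c0]. *)
pose kappa := alpha ^+ 2 / (32 * (1 + ch^-1)).
have ch10 : 0 < 1 + ch^-1 by rewrite addr_gt0 ?invr_gt0.
have kappa0 : 0 < kappa by rewrite divr_gt0 ?exprn_gt0 // mulr_gt0.
have kappaE : kappa * (1 + ch^-1) = alpha ^+ 2 / 32.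
  by rewrite /kappa; field; rewrite !gt_eqF //= ?addr_gt0.
have kappa_alpha : kappa <= alpha / 4.
  have : kappa <= kappa * (1 + ch^-1) by rewrite ler_peMr ?ltW // ltrDl invr_gt0.
  by rewrite kappaE; nra.
pose tau := delta * ch; have tau0 : 0 < tau by rewrite mulr_gt0.
pose q := tau / (1 + tau).
have q0 : 0 < q by rewrite divr_gt0 // addr_gt0.
have q1 : q <= 1 by rewrite ler_pdivrMr ?addr_gt0 // mul1r lerDr.
pose c0 := alpha ^+ 2 / 32; have c00 : 0 < c0 by rewrite divr_gt0 // exprn_gt0.
(* With [M = c0 * n] the number [z] of links is exactly [c n / d], the smallest of the three
   exponents. *)
pose c := delta * q ^+ 2 * c0 / 64.
have cpos : 0 < c by rewrite divr_gt0 // mulr_gt0 // mulr_gt0 // exprn_gt0.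
have [C hC] := nat_above (Num.max (12 / c) k.+1%:R).
have {hC} := hC C (leqnn C); rewrite ge_max => /andP[cC kC].
have {}cC : 12 <= c * C%:R by move: cC; rewrite ler_pdivrMr // mulrC.
have C0 : (0 < C)%N by rewrite -(ltr_nat R); apply: lt_le_trans kC; rewrite ltr0n.
(* In order: [1 + eps < d]; existence of [m] and of [h]; [K <= 2 ^ m]; [K <= alpha n]; the two
   conditions on [b]; the sparse vertices; the union bound. *)
have [D hD] := nat_above_all [:: expR 1 + 2 + eps; 2 / cm; 24 / (s * cm);
  2 * C%:R / cm ^+ 2; 2 * C%:R / alpha; 2 * C%:R / kappa; 2 / c;
  5 / (kappa * eta * (s * cm / 8) ^+ 2); 60 / (c * eta)].
exists D => d b /hD /= /and5P[hD1 hD2 hD3 hD4] /and5P[hD5 hD6 hD7 hD8] /andP[hD9 _] hb.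
have dR : 0 < d%:R :> R by move: hD1 eps0 (expR_gt0 (1 : R)); clear; lra.
have d0 : (0 < d)%N by rewrite -(ltr_nat R).
have d1 : 1 <= d%:R :> R by rewrite ler1n.
set n : R := (2 ^ d)%:R in hb *.
have nd : d%:R ^+ 2 / 2 <= n by apply: sqr_le_exp2R.
have n0 : 0 < n by rewrite ltr0n expn_gt0.
have nd0 : 0 < n / d%:R by rewrite divr_gt0.
have hcm : 2 <= cm * d%:R by rewrite [leRHS]mulrC -ler_pdivrMr.
have [m /andP[m1 m2]] : exists m : nat, e0 / 24 * d%:R / 2 <= m%:R <= e0 / 24 * d%:R.
  by apply: nat_between; move: hcm; rewrite /cm; clear; lra.
have {}m1 : cm * d%:R <= m%:R by move: m1; rewrite /cm; clear; lra.
have md : (m <= d)%N.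
  rewrite -(ler_nat R); apply: le_trans m2 _; rewrite ler_piMl ?ltW //; move: e00 e01; clear; lra.
have scm0 : 0 < s * cm by rewrite mulr_gt0.
have hsd : 24 <= s * cm * d%:R by rewrite [leRHS]mulrC -ler_pdivrMr.
have hsm : s * cm * d%:R <= s * m%:R by rewrite -mulrA ler_pM2l.
have [h /andP[h1 h2]] : exists h : nat, s * m%:R / 12 / 2 <= h%:R <= s * m%:R / 12.
  by apply: nat_between; move: hsd hsm; clear; lra.
have hh : ch * d%:R <= h%:R by rewrite /ch; move: h1 hsm; clear; lra.
have h0 : (0 < h)%N by rewrite -(ltr_nat R); apply: lt_le_trans hh; rewrite mulr_gt0.
have h0R : 0 < h%:R :> R by rewrite ltr0n.
have [||||p1 [p10 p11 hp p1d]] := @split_density eps e0 delta d.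
- by rewrite e00.
- by [].
- by rewrite delta0.
- by move: hD1 (expR_gt0 (1 : R)); clear; lra.
have [_ s1 hth] : [/\ 0 < s, s < 1 & theta <= (1 - s) * (1 + s * (p1 * (d - m - 2 * m)%:R))].
  by apply: theta_bound; rewrite ?e00.
set p := (1 + eps) / d%:R in hp *; set p2 := delta / d%:R in hp.
have delta1 : delta <= 1 by move: delta_e e01; clear; lra.
have p20 : 0 < p2 by rewrite divr_gt0.
have hp2 : 0 <= p2 <= 1.
  rewrite ltW //= /p2 ler_pdivrMr // mul1r; exact: le_trans delta1 d1.
have Cd : 0 < C%:R :> R by rewrite ltr0n.
have d3 : 0 < d%:R ^+ 3 :> R by rewrite exprn_gt0.
have zE : p2 * (q * (q * (c0 * n) / 4) / 4) / 4 = c * n / d%:R.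
  by rewrite /p2 /c; field; rewrite gt_eqF.
have Cd2 : 2 * C%:R <= kappa * d%:R by rewrite [leRHS]mulrC -ler_pdivrMr.
have cd2 : 2 <= c * d%:R by rewrite [leRHS]mulrC -ler_pdivrMr.
have nd2 : 0 < n / d%:R ^+ 2 by rewrite divr_gt0 // exprn_gt0.
(* [K = C * d], and [m] also serves as the exponent [t] with [K <= 2 ^ t]. *)
apply: le_trans (@not_expanding_prob R d m h k (C * d) m alpha kappa b p p1 p2 tau (c0 * n) s theta
  d0 h0 _ _ alpha0 _ hp2 (ltW tau0) _ _ _ kappa0 kappa_alpha _ _ p10 p11 hp (ltW s0) s1 theta1 _ hth md _) _.
- by rewrite muln_gt0 C0.
- apply: (@leq_trans C); last by rewrite leq_pmulr.
  by rewrite -(ler_nat R); apply: le_trans kC; rewrite ler_nat.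
- rewrite natrM -/n; apply: (@le_trans _ _ (alpha * (d%:R ^+ 2 / 2))); last by rewrite ler_pM2l.
  have : 2 * C%:R <= alpha * d%:R by rewrite [leRHS]mulrC -ler_pdivrMr.
  by rewrite -(ler_pM2r dR) expr2; clear; lra.
- rewrite /tau /p2 -mulrA ler_pM2l // mulrC ler_pdivlMr //.
- rewrite -/n natrM; apply: (@le_trans _ _ (2 * (C%:R * d%:R) * (n / d%:R ^+ 3))).
    by apply: ler_wpM2l => //; rewrite !mulr_ge0.
  have -> : 2 * (C%:R * d%:R) * (n / d%:R ^+ 3) = 2 * C%:R * (n / d%:R ^+ 2).
    by field; rewrite gt_eqF.
  have -> : kappa * n / d%:R = kappa * d%:R * (n / d%:R ^+ 2) by field; rewrite gt_eqF.
  by rewrite ler_pM2r.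
- rewrite -/q zE; apply: (@le_trans _ _ (2 * d%:R * (n / d%:R ^+ 3))).
    by apply: ler_wpM2l => //; rewrite !mulr_ge0.
  have -> : 2 * d%:R * (n / d%:R ^+ 3) = 2 * (n / d%:R ^+ 2) by field; rewrite gt_eqF.
  have -> : c * n / d%:R = c * d%:R * (n / d%:R ^+ 2) by field; rewrite gt_eqF.
  by rewrite ler_pM2r.
- by rewrite ltW // mulr_gt0.
- rewrite -/n ler_pM2r //.
  have : kappa * (1 + d%:R / h%:R) <= alpha ^+ 2 / 32.
    by rewrite -kappaE ler_pM2l // lerD2l ler_pdivrMr // ler_pdivlMl.
  by rewrite /c0 !expr2; clear; lra.
- have : (C * d)%:R <= (2 ^ m)%:R :> R.
    apply: le_trans (sqr_le_exp2R m); rewrite natrM.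
    have : cm ^+ 2 * d%:R ^+ 2 <= m%:R ^+ 2.
      by rewrite -exprMn lerXn2r ?nnegrE // mulr_ge0 // ltW.
    have : 2 * C%:R <= cm ^+ 2 * d%:R by rewrite [leRHS]mulrC -ler_pdivrMr // exprn_gt0.
    rewrite -(ler_pM2r dR) [d%:R ^+ 2]expr2; clear; lra.
  by rewrite ler_nat.
- by rewrite natrM; move: h2; clear; lra.
have t2 : d%:R / kappa * expR (- (s * m%:R / 4)) <= eta / 5.
  set y := s * m%:R / 4.
  have y0 : 0 <= s * cm * d%:R / 4 by rewrite divr_ge0 // mulr_ge0 // ltW.
  have e2 : (s * cm / 8) ^+ 2 * d%:R ^+ 2 <= expR y.
    apply: (@le_trans _ _ ((s * cm * d%:R / 4 / 2) ^+ 2)).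
      by rewrite -exprMn; have -> : s * cm / 8 * d%:R = s * cm * d%:R / 4 / 2 by field.
    apply: le_trans (sqr_le_expR y0) _; rewrite ler_expR /y; move: hsm; clear; lra.
  rewrite expRN ler_pdivrMr ?expR_gt0 // ler_pdivrMr //.
  have : eta * kappa * ((s * cm / 8) ^+ 2 * d%:R ^+ 2) <= eta * kappa * expR y.
    by rewrite ler_pM2l // mulr_gt0.
  have : 5 <= d%:R * (kappa * eta * (s * cm / 8) ^+ 2).
    by rewrite -ler_pdivrMr // mulr_gt0 ?exprn_gt0 ?divr_gt0 // mulr_gt0.
  rewrite -(ler_pM2r dR) [d%:R ^+ 2]expr2; move: (_ ^+ 2) (expR y) => a u; clear; lra.
have t3 : 48 * k%:R * p2 * d%:R / alpha <= eta / 5.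
  by rewrite -[48 * k%:R * p2 * _]mulrA divfK ?gt_eqF.
have t4 : expR (6 * n / (C * d)%:R) * (expR (- (q * (c0 * n) / (4 * d%:R)))
   + expR (- (q * (q * (c0 * n) / 4) / (4 * d%:R)))
   + expR (- (p2 * (q * (q * (c0 * n) / 4) / 4) / 4))) <= eta / 5.
  rewrite natrM; apply: le_trans (exp_decay_union cpos dR n0 eta0 cC nd _); last first.
    by rewrite mulrC -ler_pdivrMr // mulr_gt0.
  rewrite ler_pM2l ?expR_gt0 // zE.
  have cE : c * n / d%:R = c * (n / d%:R) by rewrite mulrA.
  have q2 : q ^+ 2 <= q by rewrite expr2 ler_piMl // ltW.
  have dq : delta * q ^+ 2 <= q ^+ 2 by rewrite ler_piMl // exprn_ge0 // ltW.
  have l1 : expR (- (q * (c0 * n) / (4 * d%:R))) <= expR (- (c * n / d%:R)).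
    rewrite ler_expR lerN2.
    have -> : q * (c0 * n) / (4 * d%:R) = q * c0 / 4 * (n / d%:R) by field; rewrite gt_eqF.
    rewrite cE ler_pM2r // /c; have := le_trans dq q2; rewrite -(ler_pM2r c00).
    have := mulr_gt0 q0 c00; clear; lra.
  have l2 : expR (- (q * (q * (c0 * n) / 4) / (4 * d%:R))) <= expR (- (c * n / d%:R)).
    rewrite ler_expR lerN2.
    have -> : q * (q * (c0 * n) / 4) / (4 * d%:R) = q ^+ 2 * c0 / 16 * (n / d%:R) by field; rewrite gt_eqF.
    rewrite cE ler_pM2r // /c; have := dq; rewrite -(ler_pM2r c00).
    have : 0 < q ^+ 2 * c0 by rewrite mulr_gt0 // exprn_gt0.
    clear; lra.
  by move: l1 l2; clear; lra.
rewrite -/n -/q; apply: le_trans (lerD (lerD hk t2) (lerD t3 t4)) _; move: eta0; clear; lra.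
Qed.

End Asymptotics.

(** * Passing to the stated probability *)

Lemma qprob_bern (R : realType) (d : nat) (p : R) (A : {set {set cube d}} -> bool) :
  qprob p A = bern p (qedges d) (fun G => (A G)%:R).
Proof.
rewrite /qprob /bern big_mkcondr; apply: eq_bigr => G _.
by rewrite /qweight; case: (A G); rewrite ?mulr1 ?mulr0.
Qed.

Theorem theorem1p4 (R : realType) :
  forall eps : R, 0 < eps ->
  exists alpha0 : R, 0 < alpha0 /\
  forall alpha : R, 0 < alpha -> alpha <= alpha0 ->
  exists beta : R, 0 < beta /\
  forall eta : R, 0 < eta ->
  exists D : nat, forall d : nat, (D <= d)%N ->
    1 - eta <=
    qprob ((1 + eps) / d%:R)
      (fun G : {set {set cube d}} =>
         [forall L1 : {set cube d}, is_largest_comp G L1 ==>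
           [forall S : {set cube d},
              [&& S \subset L1,
                  alpha * (2 ^ d)%:R <= #|S|%:R
                & (#|S|.*2 <= #|L1|)%N]
              ==>
              (beta * (2 ^ d)%:R / ((d%:R) ^+ 3 * (ln (d%:R : R)) ^+ 2)
                 <= #|eboundary G S|%:R)]]).
Proof.
move=> eps eps0; exists 1; split=> // alpha alpha0 alpha1; exists 1; split=> // eta eta0.
have [D1 hD1] := not_expanding_whp eps0 alpha0 alpha1 eta0.
(* For [d >= e] the logarithm is at least 1, so the bound of the theorem with [beta = 1] is at most
   [n / d ^+ 3]. *)
have [D2 hD2] := nat_above (expR (1 : R)).
exists (maxn D1 D2) => d; rewrite geq_max => /andP[/hD1 {}hD1 /hD2 {}hD2].
pose b : R := 1 * (2 ^ d)%:R / (d%:R ^+ 3 * ln (d%:R : R) ^+ 2).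
have dR : 0 < d%:R :> R by apply: lt_le_trans hD2; apply: expR_gt0.
have ln1 : 1 <= ln (d%:R : R).
  by rewrite -[leLHS]expRK ler_ln ?posrE ?expR_gt0 //.
have ln0 : 0 < ln (d%:R : R) := lt_le_trans ltr01 ln1.
have d3 : 0 < d%:R ^+ 3 :> R by rewrite exprn_gt0.
have hb : b <= (2 ^ d)%:R / d%:R ^+ 3.
  rewrite /b mul1r ler_wpM2l // lef_pV2 ?posrE ?mulr_gt0 //.
  by rewrite ler_peMr ?exprn_ege1 // ltW.
rewrite qprob_bern lerBlDr -lerBlDl; apply: le_trans (hD1 b hb).
rewrite le_eqVlt; apply/orP; left; apply/eqP.
rewrite -[X in X - _](bern_cst ((1 + eps) / d%:R) (qedges d)) -bernB.
by apply: eq_bern => G _; rewrite -/(expanding alpha b G); case: (expanding _ _ _);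
  rewrite /= ?subrr ?subr0.
Qed.
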